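(* Let $\tilde L_n^{(\tilde r,\tilde s)}(\alpha,x,y,z,a)$ be the generalized $q$-polynomials defined in the context. (i) For $|\omega x|<1$, we have $$\sum_{n=0}^\infty\sum_{m=0}^\infty\tilde L_{n+m}^{(\tilde r,\tilde s)}(\alpha,x,y,z,a)\frac{t^n}{(q;q)_n}\frac{\omega^m}{(q;q)_m}=\frac{(y\omega;q)_\infty}{(x\omega;q)_\infty}\sum_{k=0}^\infty\sum_{j=0}^k q^{k\alpha+\tilde r\binom k2-\tilde s\binom{k+1}2}\frac{(-q^{-\alpha},a;q)_k(\omega z)^k}{(-q;q)_k(q;q)_{k-j}}\frac{(x\omega;q)_j(t/\omega)^j}{(y\omega,q;q)_j}\;{}_2\Phi_1\left[\begin{array}{c} y/x,0 \\ {y\omega q^j} \end{array};q;xt\right].$$ (ii) For $\max\{|\omega x|,|xt|\}<1$ and $\tilde r=\tilde s=0$, we have $$\sum_{n=0}^\infty\sum_{m=0}^\infty\tilde L_{n+m}^{(0,0)}(\alpha,x,y,z,a)\frac{t^n}{(q;q)_n}\frac{\omega^m}{(q;q)_m}=\frac{(y\omega;q)_\infty}{(x\omega;q)_\infty}\sum_{k=0}^\infty\sum_{j=0}^k q^{k\alpha}\frac{(-q^{-\alpha},a;q)_k(\omega z)^k}{(-q;q)_k(q;q)_{k-j}}\frac{(x\omega;q)_j(t/\omega)^j}{(y\omega,q;q)_j}\;{}_2\Phi_1\left[\begin{array}{c} y/x,0 \\ {y\omega q^j} \end{array};q;xt\right].$$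
   Context: Throughout, $q$ is a fixed nonzero real or complex number with $|q|<1$, $\alpha\in\mathbb{C}$, and $\tilde r,\tilde s$ are real numbers. Notation: $(a;q)_0=1$, $(a;q)_n=\prod_{k=0}^{n-1}(1-aq^k)$, $(a;q)_\infty=\prod_{k=0}^\infty(1-aq^k)$, $(a_1,\ldots,a_r;q)_n=(a_1;q)_n\cdots(a_r;q)_n$. $q$-binomial coefficients: for $\alpha\in\mathbb{C}$ and integers $k\ge 0$, $$\begin{bmatrix} \alpha \\ k \end{bmatrix}_q=\frac{(q^{-\alpha};q)_k}{(q;q)_k}(-1)^kq^{\alpha k-\binom k2},\qquad \begin{bmatrix} \alpha \\ k \end{bmatrix}_{-q}=\frac{(-q^{-\alpha};q)_k}{(-q;q)_k}q^{\alpha k-\binom k2}.$$ Cauchy polynomials: $p_n(x,y)=(x-y)(x-qy)\cdots(x-q^{n-1}y)=(y/x;q)_n\,x^n$, $p_0=1$. Generalized $q$-polynomials: $$\tilde L_n^{(\tilde r,\tilde s)}(\alpha,x,y,z,a)=\sum_{k=0}^n\begin{bmatrix} n \\ k \end{bmatrix}_q\begin{bmatrix} \alpha \\ k \end{bmatrix}_{-q}q^{\tilde r\binom k2-\tilde s\binom{k+1}2+\binom k2}(a;q)_k\,p_{n-k}(x,y)\,z^k.$$ Basic hypergeometric series: ${}_2\Phi_1\left[\begin{array}{c} a_1,a_2 \\ {b_1} \end{array};q;w\right]=\sum_{n=0}^\infty\frac{(a_1,a_2;q)_n}{(b_1;q)_n}\frac{w^n}{(q;q)_n}$.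
   Formalization: Added: x,ω≠0 and yωq^i≠1 (right side defined); in (i) absolute convergence of the 2Φ1's; in (i),(ii) absolute convergence of Σ_k q^{kα+r̃C(k,2)-s̃C(k+1,2)}(-q^{-α},a;q)_k u^k/(-q;q)_k for u=ωz and u=tz. Without these the series can diverge. *)

(* Defs.v *)
(* Stdlib reals with Coquelicot; all parameters live in Coquelicot's [C]. *)
From Stdlib Require Import Reals.
From Coquelicot Require Import Coquelicot.
Open Scope C_scope.

Definition Cexp (z : C) : C :=
  (exp (Re z) * cos (Im z), exp (Re z) * sin (Im z))%R.

(* Complex powers of [q].  [lq] is a determination of log q, that is
   [Cexp lq = q]; the same one is used for every non-integer exponent. *)
Definition qpow (lq b : C) : C := Cexp (b * lq).

Definition binom2 (k : nat) : R := (INR k * (INR k - 1) / 2)%R.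

(* Total limit and sum of a complex sequence, componentwise; as with [Lim_seq],
   the value is only meaningful for convergent sequences. *)
Definition CLim_seq (u : nat -> C) : C :=
  (real (Lim_seq (fun n => Re (u n))), real (Lim_seq (fun n => Im (u n)))).

Definition CSeries (u : nat -> C) : C :=
  CLim_seq (fun n => sum_n u n).

Fixpoint Cprod (f : nat -> C) (n : nat) : C :=
  match n with
  | O => 1
  | S m => Cprod f m * f m
  end.

Definition qpoch (a q : C) (n : nat) : C := Cprod (fun k => 1 - a * q ^ k) n.

Definition qpoch2 (a b q : C) (n : nat) : C := qpoch a q n * qpoch b q n.

Definition qpoch_inf (a q : C) : C := CLim_seq (qpoch a q).

Definition qbin (q lq b : C) (k : nat) : C :=
  qpoch (qpow lq (- b)) q k / qpoch q q k * (- 1) ^ k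
  * qpow lq (b * INR k - binom2 k).

(* The symbol [b, k]_{-q}; it is not [qbin] with [q] replaced by [-q], since
   the q-shifted factorials keep the base [q]. *)
Definition qbin_neg (q lq b : C) (k : nat) : C :=
  qpoch (- qpow lq (- b)) q k / qpoch (- q) q k
  * qpow lq (b * INR k - binom2 k).

Definition cauchy_poly (q x y : C) (n : nat) : C :=
  Cprod (fun k => x - q ^ k * y) n.

Definition Lpoly (q lq : C) (r s : R) (alpha x y z a : C) (n : nat) : C :=
  sum_n (fun k : nat =>
    qbin q lq (INR n) k * qbin_neg q lq alpha k
    * qpow lq (r * binom2 k - s * binom2 (S k) + binom2 k)
    * qpoch a q k * cauchy_poly q x y (n - k) * z ^ k) n.

Definition phi21_term (a1 a2 b1 q w : C) (n : nat) : C :=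
  qpoch2 a1 a2 q n / qpoch b1 q n * (w ^ n / qpoch q q n).

Definition phi21 (a1 a2 b1 q w : C) : C := CSeries (phi21_term a1 a2 b1 q w).

(* q^e (-q^{-alpha}, a; q)_k u^k / (-q; q)_k *)
Definition kfactor (q lq alpha a e u : C) (k : nat) : C :=
  qpow lq e * (qpoch2 (- qpow lq (- alpha)) a q k * u ^ k / qpoch (- q) q k).

Definition ex_series_abs (u : nat -> C) : Prop :=
  ex_series (fun n => Cmod (u n)).

(* sum_n sum_m u n m = l as an iterated sum, every series being convergent. *)
Definition is_iterated_series (u : nat -> nat -> C) (l : C) : Prop :=
  exists v : nat -> C, (forall n, is_series (u n) (v n)) /\ is_series v l.

(* Main.v *)
Require Import Defs.
From Stdlib Require Import Reals Lra Lia.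
From Coquelicot Require Import Coquelicot.
Open Scope C_scope.

(* Let kap_k be the coefficient [kfactor] taken at u = z, so that
   L_N = sum_k [N, k]_q kap_k p_(N-k)(x, y).  Writing k = i + j, the q-Vandermonde
   identity turns the (n, m) term of the left-hand side into a sum over i <= n,
   j <= m of
     kap_(i+j) t^i w^j / ((q)_i (q)_j) * p_(l+m') t^l w^m' / ((q)_l (q)_m') * q^(i m')
   with l = n - i and m' = m - j.  Summing this quadruple family over m' by the
   q-binomial theorem, then over l, gives the 2Phi1 series, and grouping by
   k = i + j gives the right-hand side.  The rearrangement is legitimate because
   absolute convergence of the k-series (whose terms are exp of a quadratic in k
   times a factor that is eventually zero or bounded away from 0) and of the
   2Phi1 series already forces geometric decay, so that the quadruple family is
   dominated by K th^(i+j+l+m'). *)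

(** * Limits and rearrangement of complex series *)

(** The two sides group the four indices differently: the left collects (i, l) into n and (j, m')
    into m, the right collects (i, j) into k. With m' summed innermost on both sides, the only
    genuine exchange of infinite sums is that of j with l for fixed i.

    The coupling factor q^(i m') is what produces the right-hand side: it moves the argument of the
    q-binomial series from x w to x w q^i, and hence the lower parameter of the 2Phi1 from y w to y
    w q^i.

    In the domination, kap is evaluated at i + j while the powers t^i w^j are split, so neither the
    series at t z nor the one at w z controls it alone. Decay along both pure powers does, and the
    same holds for the Cauchy polynomial, evaluated at l + m'. In (i), where |x t| < 1 is not
    assumed, the decay at x t has to be extracted from the convergence of the 2Phi1 series. *)

Lemma Cminus_0_eq (a b : C) : a - b = 0 -> a = b.
Proof. intros H; replace a with (a - b + b) by ring; rewrite H; ring. Qed.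

(* [sum_n] leaves equalities in [C_AbelianMonoid], which [ring] does not see as [C]. *)
Ltac cring := apply Cminus_0_eq; ring.

Definition Clim (u : nat -> C) (l : C) : Prop :=
  forall eps : R, (0 < eps)%R ->
  exists N : nat, forall n : nat, (N <= n)%nat -> (Cmod (u n - l) < eps)%R.

(** The uniform structure on [C] is the product of two real ones, so a ball of radius eps only
    bounds the modulus by sqrt 2 * eps. This is why the converse direction rescales eps. *)
Lemma Clim_filterlim (u : nat -> C) (l : C) :
  Clim u l <-> filterlim u eventually (@locally C_UniformSpace l).
Proof.
  split.
  - intros H P [eps HP].
    destruct (H eps (cond_pos eps)) as [N HN].
    exists N; intros n Hn; apply HP.
    apply (C_NormedModule_mixin_compat1 l (u n) eps), HN, Hn.
  - intros H eps Heps.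
    assert (Hs : (0 < sqrt 2)%R) by (apply sqrt_lt_R0; lra).
    assert (He : (0 < eps / sqrt 2)%R) by (apply Rdiv_lt_0_compat; lra).
    destruct (H (fun y => ball l (mkposreal _ He) y)) as [N HN].
    { exists (mkposreal _ He); auto. }
    exists N; intros n Hn.
    replace eps with (sqrt 2 * (eps / sqrt 2))%R by (field; lra).
    exact (C_NormedModule_mixin_compat2 l (u n) (mkposreal _ He) (HN n Hn)).
Qed.

Lemma is_series_Clim (u : nat -> C) (l : C) :
  is_series u l <-> Clim (sum_n u) l.
Proof. symmetry; apply Clim_filterlim. Qed.

Lemma csum_S (u : nat -> C) (n : nat) :
  sum_n u (S n) = sum_n u n + u (S n).
Proof. exact (sum_Sn u n). Qed.

Lemma csum_mult (c : C) (u : nat -> C) (n : nat) :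
  sum_n (fun k => c * u k) n = c * sum_n u n.
Proof. exact (sum_n_mult_l (K := C_Ring) c u n). Qed.

Lemma csum_plus (u v : nat -> C) (n : nat) :
  sum_n (fun k => u k + v k) n = sum_n u n + sum_n v n.
Proof. exact (sum_n_plus u v n). Qed.

Lemma csum_shift (u : nat -> C) (n : nat) :
  sum_n u (S n) = u O + sum_n (fun k => u (S k)) n.
Proof.
  induction n as [|n IH].
  - rewrite csum_S, !sum_O; reflexivity.
  - rewrite csum_S, IH, csum_S; cring.
Qed.

Lemma Clim_components (u : nat -> C) (a b : R) :
  is_lim_seq (fun n => Re (u n)) a -> is_lim_seq (fun n => Im (u n)) b ->
  Clim u (a, b).
Proof.
  intros Ha Hb eps Heps.
  assert (He : (0 < eps / 2)%R) by lra.
  apply is_lim_seq_spec in Ha; apply is_lim_seq_spec in Hb.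
  destruct (Ha (mkposreal _ He)) as [N1 H1].
  destruct (Hb (mkposreal _ He)) as [N2 H2].
  exists (N1 + N2)%nat; intros n Hn.
  specialize (H1 n ltac:(lia)); specialize (H2 n ltac:(lia)); simpl in H1, H2.
  replace (u n - (a, b))
    with (RtoC (Re (u n) - a) + Ci * RtoC (Im (u n) - b))
    by (destruct (u n); unfold RtoC, Ci, Re, Im; simpl;
        apply injective_projections; simpl; ring).
  eapply Rle_lt_trans; [apply Cmod_triangle|].
  rewrite Cmod_mult, Cmod_Ci, !Cmod_R; lra.
Qed.

Lemma im_le_Cmod (c : C) : (Rabs (Im c) <= Cmod c)%R.
Proof.
  eapply Rle_trans; [|apply Rmax_Cmod]; apply Rmax_r.
Qed.

Lemma Clim_CLim_seq (u : nat -> C) (l : C) : Clim u l -> CLim_seq u = l.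
Proof.
  intros H; unfold CLim_seq; destruct l as [a b].
  rewrite (is_lim_seq_unique (fun n => Re (u n)) a).
  - rewrite (is_lim_seq_unique (fun n => Im (u n)) b); [reflexivity|].
    apply is_lim_seq_spec; intros eps.
    destruct (H eps (cond_pos eps)) as [N HN]; exists N; intros n Hn.
    eapply Rle_lt_trans; [|apply (HN n Hn)].
    exact (im_le_Cmod (u n - (a, b))).
  - apply is_lim_seq_spec; intros eps.
    destruct (H eps (cond_pos eps)) as [N HN]; exists N; intros n Hn.
    eapply Rle_lt_trans; [|apply (HN n Hn)].
    exact (re_le_Cmod (u n - (a, b))).
Qed.

Lemma CSeries_unique (u : nat -> C) (l : C) : is_series u l -> CSeries u = l.
Proof. intros H; apply Clim_CLim_seq, is_series_Clim, H. Qed.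

Lemma Clim_unique (u : nat -> C) (l m : C) : Clim u l -> Clim u m -> l = m.
Proof.
  intros Hl Hm; rewrite <- (Clim_CLim_seq u l Hl); apply Clim_CLim_seq, Hm.
Qed.

Lemma Clim_ext (u v : nat -> C) (l : C) :
  (forall n, u n = v n) -> Clim u l -> Clim v l.
Proof.
  intros E H eps Heps; destruct (H eps Heps) as [N HN]; exists N; intros n Hn.
  rewrite <- E; auto.
Qed.

Lemma Clim_const (c : C) : Clim (fun _ => c) c.
Proof.
  intros eps Heps; exists O; intros n _.
  replace (c - c) with (RtoC 0) by ring; rewrite Cmod_0; exact Heps.
Qed.

Lemma Clim_plus (u v : nat -> C) (l m : C) :
  Clim u l -> Clim v m -> Clim (fun n => u n + v n) (l + m).
Proof.
  intros Hu Hv eps Heps.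
  destruct (Hu (eps / 2)%R ltac:(lra)) as [N1 H1].
  destruct (Hv (eps / 2)%R ltac:(lra)) as [N2 H2].
  exists (N1 + N2)%nat; intros n Hn.
  replace (u n + v n - (l + m)) with ((u n - l) + (v n - m)) by ring.
  eapply Rle_lt_trans; [apply Cmod_triangle|].
  specialize (H1 n ltac:(lia)); specialize (H2 n ltac:(lia)); lra.
Qed.

Lemma Clim_scal (c : C) (u : nat -> C) (l : C) :
  Clim u l -> Clim (fun n => c * u n) (c * l).
Proof.
  intros Hu eps Heps.
  pose proof (Cmod_ge_0 c) as Hc.
  destruct (Hu (eps / (Cmod c + 1))%R) as [N HN].
  { apply Rdiv_lt_0_compat; lra. }
  exists N; intros n Hn.
  replace (c * u n - c * l) with (c * (u n - l)) by ring.
  rewrite Cmod_mult; specialize (HN n Hn).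
  apply Rle_lt_trans with (Cmod c * (eps / (Cmod c + 1)))%R.
  - apply Rmult_le_compat_l; lra.
  - replace eps with ((Cmod c + 1) * (eps / (Cmod c + 1)))%R at 2
      by (field; lra).
    apply Rmult_lt_compat_r; [apply Rdiv_lt_0_compat; lra | lra].
Qed.

Lemma Clim_bounded (u : nat -> C) (l : C) (K : R) :
  (forall n, (Cmod (u n) <= K)%R) -> Clim u l -> (Cmod l <= K)%R.
Proof.
  intros Hu Hl; apply Rnot_lt_le; intros Hlt.
  destruct (Hl (Cmod l - K)%R ltac:(lra)) as [N HN].
  specialize (HN N (Nat.le_refl N)); specialize (Hu N).
  assert (Ht := Cmod_triangle (u N) (- (u N - l))).
  replace (u N + - (u N - l)) with l in Ht by ring.
  rewrite Cmod_opp in Ht; lra.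
Qed.

Lemma Clim_mult (u v : nat -> C) (l m : C) :
  Clim u l -> Clim v m -> Clim (fun n => u n * v n) (l * m).
Proof.
  intros Hu Hv eps Heps.
  pose proof (Cmod_ge_0 l) as Hl; pose proof (Cmod_ge_0 m) as Hm.
  set (d := Rmin 1 (eps / (Cmod l + Cmod m + 1))).
  assert (Hd : (0 < d)%R).
  { apply Rmin_pos; [lra|]; apply Rdiv_lt_0_compat; lra. }
  assert (Hd1 : (d <= 1)%R) by apply Rmin_l.
  assert (Hd2 : (d * (Cmod l + Cmod m + 1) <= eps)%R).
  { apply Rle_trans
      with (eps / (Cmod l + Cmod m + 1) * (Cmod l + Cmod m + 1))%R.
    - apply Rmult_le_compat_r; [lra | apply Rmin_r].
    - apply Req_le; field; lra. }
  destruct (Hu d Hd) as [N1 H1]; destruct (Hv d Hd) as [N2 H2].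
  exists (N1 + N2)%nat; intros n Hn.
  specialize (H1 n ltac:(lia)); specialize (H2 n ltac:(lia)).
  replace (u n * v n - l * m)
    with ((u n - l) * (v n - m) + (l * (v n - m) + m * (u n - l))) by ring.
  eapply Rle_lt_trans; [apply Cmod_triangle|].
  assert (Ht := Cmod_triangle (l * (v n - m)) (m * (u n - l))).
  rewrite !Cmod_mult in *.
  pose proof (Cmod_ge_0 (u n - l)); pose proof (Cmod_ge_0 (v n - m)).
  nra.
Qed.

Lemma Clim_shift (k : nat) (u : nat -> C) (l : C) :
  Clim u l -> Clim (fun n => u (k + n)%nat) l.
Proof.
  intros Hu eps Heps; destruct (Hu eps Heps) as [N HN].
  exists N; intros n Hn; apply HN; lia.
Qed.

Lemma Clim_sum_n (f : nat -> nat -> C) (v : nat -> C) (A : nat) :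
  (forall a, Clim (fun N => f N a) (v a)) ->
  Clim (fun N => sum_n (f N) A) (sum_n v A).
Proof.
  intros H; induction A as [|A IH].
  - rewrite sum_O; apply (Clim_ext (fun N => f N O)); [|apply H].
    intros n; rewrite sum_O; reflexivity.
  - rewrite csum_S; apply (Clim_ext (fun N => sum_n (f N) A + f N (S A))).
    + intros n; rewrite csum_S; reflexivity.
    + apply Clim_plus; auto.
Qed.

Lemma is_series_scal_C (c : C) (u : nat -> C) (l : C) :
  is_series u l -> is_series (fun n => c * u n) (c * l).
Proof.
  intros H; apply is_series_Clim.
  apply (Clim_ext (fun n => c * sum_n u n)).
  - intros n; symmetry; apply csum_mult.
  - apply Clim_scal, is_series_Clim, H.
Qed.

Lemma is_series_sum_n (f : nat -> nat -> C) (v : nat -> C) (A : nat) :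
  (forall a, is_series (f a) (v a)) ->
  is_series (fun n => sum_n (fun a => f a n) A) (sum_n v A).
Proof.
  intros H; apply is_series_Clim.
  apply (Clim_ext (fun N => sum_n (fun a => sum_n (f a) N) A)).
  - intros N; apply (sum_n_switch (G := C_AbelianMonoid)).
  - apply Clim_sum_n; intros a; apply is_series_Clim, H.
Qed.

Lemma CSeries_ext (u v : nat -> C) :
  (forall n, u n = v n) -> CSeries u = CSeries v.
Proof.
  intros H; unfold CSeries, CLim_seq; f_equal; f_equal; apply Lim_seq_ext;
  intros n; rewrite (sum_n_ext _ _ n H); reflexivity.
Qed.

(** Explicit geometric majorants are stable: partial sums, full sums, tails and limits of such
    families inherit bounds of the same shape, so multiple sums can be bounded one index at a time
    with the same [th]. *)
Definition geo_le (K th : R) (u : nat -> C) : Prop :=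
  forall n, (Cmod (u n) <= K * th ^ n)%R.

Lemma geo_le_pos (K th : R) (u : nat -> C) : geo_le K th u -> (0 <= K)%R.
Proof.
  intros H; specialize (H O); simpl in H.
  pose proof (Cmod_ge_0 (u O)); lra.
Qed.

Lemma ex_series_geo (K th : R) :
  (0 <= th < 1)%R -> ex_series (fun n => K * th ^ n)%R.
Proof.
  intros H; apply (ex_series_scal (K := R_AbsRing) K (fun n => th ^ n)%R).
  apply ex_series_geom; rewrite Rabs_pos_eq; lra.
Qed.

Lemma is_series_abs (u : nat -> C) (g : nat -> R) :
  (forall n, (Cmod (u n) <= g n)%R) -> ex_series g -> is_series u (CSeries u).
Proof.
  intros Hu Hg.
  assert (Hre : ex_series (fun n => Re (u n))).
  { apply (ex_series_le (V := R_CompleteNormedModule) _ g); [|exact Hg].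
    intros n; eapply Rle_trans; [apply re_le_Cmod | apply Hu]. }
  assert (Him : ex_series (fun n => Im (u n))).
  { apply (ex_series_le (V := R_CompleteNormedModule) _ g); [|exact Hg].
    intros n; eapply Rle_trans; [apply im_le_Cmod | apply Hu]. }
  assert (E : Clim (sum_n u)
                (Series (fun n => Re (u n)), Series (fun n => Im (u n)))).
  { apply Clim_components.
    - eapply is_lim_seq_ext; [|exact (Series_correct _ Hre)].
      intros n; induction n as [|n IH]; [rewrite !sum_O; reflexivity|].
      rewrite csum_S, sum_Sn, IH; reflexivity.
    - eapply is_lim_seq_ext; [|exact (Series_correct _ Him)].
      intros n; induction n as [|n IH]; [rewrite !sum_O; reflexivity|].
      rewrite csum_S, sum_Sn, IH; reflexivity. }
  apply is_series_Clim; change (CSeries u) with (CLim_seq (sum_n u)).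
  rewrite (Clim_CLim_seq _ _ E); exact E.
Qed.

Lemma is_series_geo (K th : R) (u : nat -> C) :
  (0 <= th < 1)%R -> geo_le K th u -> is_series u (CSeries u).
Proof.
  intros Hth Hu; apply (is_series_abs _ _ Hu), ex_series_geo, Hth.
Qed.

Lemma csum_le_geo (K th : R) (u : nat -> C) (n : nat) :
  (0 <= th < 1)%R -> geo_le K th u -> (Cmod (sum_n u n) <= K / (1 - th))%R.
Proof.
  intros Hth Hu.
  assert (HK := geo_le_pos _ _ _ Hu).
  assert (H : (Cmod (sum_n u n) <= K / (1 - th) * (1 - th ^ S n))%R).
  { induction n as [|n IH].
    - rewrite sum_O; eapply Rle_trans; [apply Hu|].
      apply Req_le; simpl; field; lra.
    - rewrite csum_S; eapply Rle_trans; [apply Cmod_triangle|].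
      eapply Rle_trans; [apply Rplus_le_compat; [apply IH | apply Hu]|].
      apply Req_le; simpl; field; lra. }
  eapply Rle_trans; [exact H|].
  rewrite <- (Rmult_1_r (K / (1 - th))) at 2.
  apply Rmult_le_compat_l.
  - apply Rdiv_le_0_compat; lra.
  - assert (0 <= th ^ S n)%R by (apply pow_le; lra); lra.
Qed.

Lemma CSeries_le_geo (K th : R) (u : nat -> C) :
  (0 <= th < 1)%R -> geo_le K th u -> (Cmod (CSeries u) <= K / (1 - th))%R.
Proof.
  intros Hth Hu; apply (Clim_bounded (sum_n u)).
  - intros n; apply csum_le_geo; auto.
  - apply is_series_Clim, (is_series_geo K th); auto.
Qed.

Lemma csum_add (u : nat -> C) (A n : nat) :
  sum_n u (S A + n) = sum_n u A + sum_n (fun k => u (S A + k)%nat) n.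
Proof.
  induction n as [|n IH].
  - rewrite Nat.add_0_r, csum_S, sum_O, Nat.add_0_r; reflexivity.
  - rewrite Nat.add_succ_r, csum_S, IH, csum_S, Nat.add_succ_r; cring.
Qed.

Lemma CSeries_tail_geo (K th : R) (u : nat -> C) (A : nat) :
  (0 <= th < 1)%R -> geo_le K th u ->
  (Cmod (CSeries u - sum_n u A) <= K / (1 - th) * th ^ S A)%R.
Proof.
  intros Hth Hu.
  assert (Hg : geo_le (K * th ^ S A) th (fun k => u (S A + k)%nat)).
  { intros k; eapply Rle_trans; [apply Hu|].
    rewrite pow_add; apply Req_le; ring. }
  apply (Clim_bounded (fun n => sum_n u (S A + n) - sum_n u A)).
  - intros n; rewrite csum_add.
    replace (sum_n u A + sum_n (fun k => u (S A + k)%nat) n - sum_n u A)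
      with (sum_n (fun k => u (S A + k)%nat) n) by cring.
    replace (K / (1 - th) * th ^ S A)%R with (K * th ^ S A / (1 - th))%R
      by (field; lra).
    apply csum_le_geo; auto.
  - apply Clim_plus; [|apply Clim_const].
    apply (Clim_shift (S A) (sum_n u)), is_series_Clim, (is_series_geo K th); auto.
Qed.

Lemma pow_small (K th eps : R) :
  (0 <= th < 1)%R -> (0 <= K)%R -> (0 < eps)%R ->
  exists A, forall n, (A <= n)%nat -> (K * th ^ n < eps)%R.
Proof.
  intros Hth HK Heps.
  destruct (pow_lt_1_zero th ltac:(rewrite Rabs_pos_eq; lra)
              (eps / (K + 1))%R) as [A HA].
  { apply Rdiv_lt_0_compat; lra. }
  exists A; intros n Hn; specialize (HA n Hn).
  assert (0 <= th ^ n)%R by (apply pow_le; lra).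
  rewrite Rabs_pos_eq in HA by assumption.
  apply Rle_lt_trans with ((K + 1) * th ^ n)%R; [nra|].
  replace eps with ((K + 1) * (eps / (K + 1)))%R by (field; lra).
  apply Rmult_lt_compat_l; lra.
Qed.

(** Dominated convergence for series. A cut-off A makes the tails of all [f N] and of [v] smaller
    than eps / 3, and the remaining finite head converges term by term. *)
Lemma tannery (f : nat -> nat -> C) (v : nat -> C) (K th : R) :
  (0 <= th < 1)%R -> (forall N, geo_le K th (f N)) ->
  (forall a, Clim (fun N => f N a) (v a)) ->
  Clim (fun N => CSeries (f N)) (CSeries v).
Proof.
  intros Hth Hf Hv eps Heps.
  assert (HK := geo_le_pos _ _ _ (Hf O)).
  assert (Hvg : geo_le K th v).
  { intros a; apply (Clim_bounded (fun N => f N a)); [|apply Hv].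
    intros N; apply Hf. }
  assert (HK1 : (0 <= K / (1 - th))%R) by (apply Rdiv_le_0_compat; lra).
  destruct (pow_small _ th (eps / 3)%R Hth HK1 ltac:(lra)) as [A HA].
  destruct (Clim_sum_n f v A Hv (eps / 3)%R ltac:(lra)) as [N HN].
  exists N; intros n Hn.
  replace (CSeries (f n) - CSeries v)
    with ((CSeries (f n) - sum_n (f n) A) + (sum_n (f n) A - sum_n v A)
          + - (CSeries v - sum_n v A)) by cring.
  eapply Rle_lt_trans; [apply Cmod_triangle|].
  rewrite Cmod_opp.
  assert (Ht := Cmod_triangle (CSeries (f n) - sum_n (f n) A)
                  (sum_n (f n) A - sum_n v A)).
  assert (H1 := CSeries_tail_geo K th (f n) A Hth (Hf n)).
  assert (H2 := CSeries_tail_geo K th v A Hth Hvg).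
  assert (H3 := HA (S A) ltac:(lia)).
  assert (H4 := HN n Hn).
  lra.
Qed.

(** Both sides are the limit of one sequence, the sum over a of the rows cut at b = N: by [tannery]
    for the left side, by finite additivity of series for the right. *)
Lemma CSeries_swap (u : nat -> nat -> C) (K th : R) :
  (0 <= th < 1)%R ->
  (forall a b, (Cmod (u a b) <= K * th ^ a * th ^ b)%R) ->
  CSeries (fun a => CSeries (u a)) = CSeries (fun b => CSeries (fun a => u a b)).
Proof.
  intros Hth Hu.
  assert (Hrow : forall a, geo_le (K * th ^ a) th (u a)) by (intros a b; apply Hu).
  assert (Hcol : forall b, geo_le (K * th ^ b) th (fun a => u a b)).
  { intros b a; eapply Rle_trans; [apply Hu | apply Req_le; ring]. }
  apply (Clim_unique (fun N => CSeries (fun a => sum_n (u a) N))).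
  - apply (tannery (fun N a => sum_n (u a) N) (fun a => CSeries (u a))
             (K / (1 - th)) th Hth).
    + intros N a; eapply Rle_trans; [apply csum_le_geo; eauto|].
      apply Req_le; field; lra.
    + intros a; apply is_series_Clim; eapply is_series_geo; eauto.
  - apply (Clim_ext (sum_n (fun b => CSeries (fun a => u a b)))).
    + intros N; symmetry; apply CSeries_unique.
      apply (is_series_sum_n (fun b a => u a b)).
      intros b; eapply is_series_geo; eauto.
    + apply is_series_Clim, (is_series_geo (K / (1 - th)) th); [exact Hth|].
      intros b; eapply Rle_trans; [eapply CSeries_le_geo; eauto|].
      apply Req_le; field; lra.
Qed.

Lemma csum_triangle (u : nat -> nat -> C) (N : nat) :
  sum_n (fun n => sum_n (fun a => u a (n - a)%nat) n) N
  = sum_n (fun a => sum_n (u a) (N - a)) N.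
Proof.
  induction N as [|N IH].
  - rewrite !sum_O; reflexivity.
  - rewrite csum_S, IH, (csum_S (fun a => u a (S N - a)%nat)).
    rewrite (csum_S (fun a => sum_n (u a) (S N - a))).
    rewrite Nat.sub_diag, sum_O, Cplus_assoc, <- csum_plus.
    f_equal; apply sum_n_ext_loc; intros a Ha.
    replace (S N - a)%nat with (S (N - a)) by lia.
    rewrite csum_S; reflexivity.
Qed.

Lemma is_series_finite (u : nat -> C) (N : nat) :
  (forall n, (N < n)%nat -> u n = 0) -> is_series u (sum_n u N).
Proof.
  intros H; apply is_series_Clim; intros eps Heps; exists N; intros n Hn.
  replace (sum_n u n) with (sum_n u N).
  - replace (sum_n u N - sum_n u N) with (RtoC 0) by cring.
    rewrite Cmod_0; exact Heps.
  - induction Hn as [|n Hn IH]; [reflexivity|].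
    rewrite csum_S, <- IH, H by lia; cring.
Qed.

(** The first N antidiagonals fill the triangle a + b <= N, which is also a series over a of rows
    cut at N - a. Each row converges as N grows, so [tannery] applies. *)
Lemma is_series_triangle (u : nat -> nat -> C) (K th : R) :
  (0 <= th < 1)%R ->
  (forall a b, (Cmod (u a b) <= K * th ^ a * th ^ b)%R) ->
  is_series (fun n => sum_n (fun a => u a (n - a)%nat) n)
    (CSeries (fun a => CSeries (u a))).
Proof.
  intros Hth Hu.
  assert (Hrow : forall a, geo_le (K * th ^ a) th (u a)) by (intros a b; apply Hu).
  assert (HK : (0 <= K)%R).
  { assert (H := geo_le_pos _ _ _ (Hrow O)); simpl in H; lra. }
  apply is_series_Clim.
  (* Rows with a > N must be set to 0 by hand: the truncated difference N - a is 0 there and would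
     keep the term [u a 0]. *)
  pose (f := fun N a => if Nat.leb a N then sum_n (u a) (N - a) else RtoC 0).
  apply (Clim_ext (fun N => CSeries (f N))).
  - intros N; rewrite csum_triangle; apply CSeries_unique.
    replace (sum_n (fun a => sum_n (u a) (N - a)) N) with (sum_n (f N) N).
    + apply is_series_finite; intros n Hn; unfold f.
      destruct (Nat.leb_spec n N); [lia | reflexivity].
    + apply sum_n_ext_loc; intros a Ha; unfold f.
      destruct (Nat.leb_spec a N); [reflexivity | lia].
  - apply (tannery f (fun a => CSeries (u a)) (K / (1 - th)) th Hth).
    + intros N a; unfold f; destruct (Nat.leb a N).
      * eapply Rle_trans; [apply csum_le_geo; eauto|].
        apply Req_le; field; lra.
      * rewrite Cmod_0; apply Rmult_le_pos; [|apply pow_le; lra].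
        apply Rdiv_le_0_compat; lra.
    + intros a eps Heps.
      assert (H : Clim (sum_n (u a)) (CSeries (u a)))
        by (apply is_series_Clim; eapply is_series_geo; eauto).
      destruct (H eps Heps) as [N HN].
      exists (N + a)%nat; intros n Hn; unfold f.
      destruct (Nat.leb_spec a n); [|lia].
      apply HN; lia.
Qed.

(** * Infinite q-shifted factorials and the q-binomial theorem *)

Lemma Cone_minus_neq0 (u : C) : u <> 1 -> 1 - u <> 0.
Proof. intros H E; apply H; symmetry; apply Cminus_0_eq, E. Qed.

Lemma Cmod_mult_qpow_le (a q : C) (n : nat) :
  (Cmod q < 1)%R -> (Cmod (a * q ^ n) <= Cmod a)%R.
Proof.
  intros Hq; rewrite Cmod_mult, Cmod_pow.
  pose proof (Cmod_ge_0 a); pose proof (Cmod_ge_0 q).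
  assert (Cmod q ^ n <= 1 ^ n)%R by (apply pow_incr; lra).
  rewrite pow1 in *; nra.
Qed.

Lemma mult_qpow_neq1 (a q : C) (n : nat) :
  (Cmod q < 1)%R -> (Cmod a < 1)%R -> a * q ^ n <> 1.
Proof.
  intros Hq Ha E; assert (H := Cmod_mult_qpow_le a q n Hq).
  rewrite E, Cmod_1 in H; lra.
Qed.

Lemma qpoch_add (a q : C) (n m : nat) :
  qpoch a q (n + m) = qpoch a q n * qpoch (a * q ^ n) q m.
Proof.
  induction m as [|m IH].
  - rewrite Nat.add_0_r; unfold qpoch at 3; simpl; ring.
  - rewrite Nat.add_succ_r.
    change (qpoch a q (n + m) * (1 - a * q ^ (n + m))
            = qpoch a q n * (qpoch (a * q ^ n) q m * (1 - a * q ^ n * q ^ m))).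
    rewrite IH, Cpow_add_r; ring.
Qed.

Lemma qpoch_neq0 (a q : C) (n : nat) :
  (forall i, a * q ^ i <> 1) -> qpoch a q n <> 0.
Proof.
  intros H; induction n as [|n IH].
  - exact C1_nz.
  - apply Cmult_neq_0; [exact IH | apply Cone_minus_neq0, H].
Qed.

Lemma qpoch_q_neq0 (q : C) (n : nat) : (Cmod q < 1)%R -> qpoch q q n <> 0.
Proof. intros Hq; apply qpoch_neq0; intros i; apply mult_qpow_neq1; auto. Qed.

(** Each factor is at most exp(|a| |q|^k). The induction keeps the exact partial geometric sum of
    the exponents, which is enlarged only at the end. *)
Lemma qpoch_upper (a q : C) (n : nat) :
  (Cmod q < 1)%R -> (Cmod (qpoch a q n) <= exp (Cmod a / (1 - Cmod q)))%R.
Proof.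
  intros Hq; pose proof (Cmod_ge_0 a) as Ha; pose proof (Cmod_ge_0 q) as Hq0.
  assert (H : (Cmod (qpoch a q n)
               <= exp (Cmod a / (1 - Cmod q) * (1 - Cmod q ^ n)))%R).
  { induction n as [|n IH].
    - simpl; unfold qpoch; simpl.
      rewrite Cmod_1; rewrite <- exp_0 at 1; apply Req_le; f_equal; ring.
    - change (qpoch a q (S n)) with (qpoch a q n * (1 - a * q ^ n)).
      rewrite Cmod_mult.
      replace (Cmod a / (1 - Cmod q) * (1 - Cmod q ^ S n))%R
        with (Cmod a / (1 - Cmod q) * (1 - Cmod q ^ n) + Cmod a * Cmod q ^ n)%R
        by (simpl; field; lra).
      rewrite exp_plus.
      apply Rmult_le_compat; try apply Cmod_ge_0; [exact IH|].
      eapply Rle_trans; [|apply exp_ineq1_le].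
      eapply Rle_trans; [apply Cmod_triangle|].
      rewrite Cmod_1, Cmod_opp, Cmod_mult, Cmod_pow; lra. }
  eapply Rle_trans; [exact H|].
  assert (H1 : (0 <= Cmod q ^ n)%R) by (apply pow_le; lra).
  assert (H2 : (0 <= Cmod a / (1 - Cmod q))%R) by (apply Rdiv_le_0_compat; lra).
  assert (H3 : (Cmod a / (1 - Cmod q) * (1 - Cmod q ^ n)
                <= Cmod a / (1 - Cmod q))%R) by nra.
  destruct H3 as [H3|H3]; [left; apply exp_increasing, H3 | right; rewrite H3; reflexivity].
Qed.

(** Weierstrass' inequality: a product of factors 1 - x_k is at least 1 minus the sum of the x_k,
    here with x_k = |a| |q|^k of total at most 1/2. *)
Lemma qpoch_lower_small (a q : C) (n : nat) :
  (Cmod q < 1)%R -> (Cmod a / (1 - Cmod q) <= / 2)%R ->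
  (/ 2 <= Cmod (qpoch a q n))%R.
Proof.
  intros Hq Ha; pose proof (Cmod_ge_0 a) as Ha0; pose proof (Cmod_ge_0 q) as Hq0.
  assert (H2 : (0 <= Cmod a / (1 - Cmod q))%R) by (apply Rdiv_le_0_compat; lra).
  assert (Hp : forall k, (0 <= Cmod q ^ k <= 1)%R).
  { intros k; split; [apply pow_le; lra|].
    rewrite <- (pow1 k); apply pow_incr; lra. }
  assert (H : (1 - Cmod a / (1 - Cmod q) * (1 - Cmod q ^ n)
               <= Cmod (qpoch a q n))%R).
  { induction n as [|n IH].
    - unfold qpoch; simpl; rewrite Cmod_1; lra.
    - change (qpoch a q (S n)) with (qpoch a q n * (1 - a * q ^ n)).
      rewrite Cmod_mult.
      assert (Ht : (1 - Cmod a * Cmod q ^ n <= Cmod (1 - a * q ^ n))%R).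
      { assert (T := Cmod_triangle (1 - a * q ^ n) (a * q ^ n)).
        replace (1 - a * q ^ n + a * q ^ n) with (RtoC 1) in T by ring.
        rewrite Cmod_1, Cmod_mult, Cmod_pow in T; lra. }
      replace (Cmod a / (1 - Cmod q) * (1 - Cmod q ^ S n))%R
        with (Cmod a / (1 - Cmod q) * (1 - Cmod q ^ n) + Cmod a * Cmod q ^ n)%R
        by (simpl; field; lra).
      assert (Hpn := Hp n).
      assert (Hs : (0 <= Cmod a / (1 - Cmod q) * (1 - Cmod q ^ n) <= / 2)%R)
        by nra.
      assert (Ha1 : (Cmod a <= / 2)%R).
      { replace (Cmod a) with (Cmod a / (1 - Cmod q) * (1 - Cmod q))%R
          by (field; lra). nra. }
      set (s := (Cmod a / (1 - Cmod q) * (1 - Cmod q ^ n))%R) in *.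
      assert (Hx : (0 <= Cmod a * Cmod q ^ n <= / 2)%R) by nra.
      set (xx := (Cmod a * Cmod q ^ n)%R) in *.
      apply Rle_trans with ((1 - s) * (1 - xx))%R; [nra|].
      apply Rmult_le_compat; lra. }
  assert (Hpn := Hp n); nra.
Qed.

(** Split off K factors, with K so large that a q^K satisfies [qpoch_lower_small]. If the head
    vanishes, so do all later products; otherwise the tail cannot bring the product near 0. *)
Lemma qpoch_zero_or_bounded_below (a q : C) :
  (Cmod q < 1)%R ->
  (exists K, forall n, (K <= n)%nat -> qpoch a q n = 0) \/
  (exists d, (0 < d)%R /\ forall n, (d <= Cmod (qpoch a q n))%R).
Proof.
  intros Hq; pose proof (Cmod_ge_0 q) as Hq0.
  assert (Hc : (0 <= Cmod a / (1 - Cmod q))%R)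
    by (apply Rdiv_le_0_compat; [apply Cmod_ge_0 | lra]).
  destruct (pow_small _ (Cmod q) (/ 2)%R (conj Hq0 Hq) Hc ltac:(lra)) as [K HK].
  assert (HT : forall m, (/ 2 <= Cmod (qpoch (a * q ^ K) q m))%R).
  { intros m; apply qpoch_lower_small; [exact Hq|].
    rewrite Cmod_mult, Cmod_pow; specialize (HK K (Nat.le_refl K)).
    left; eapply Rle_lt_trans; [|exact HK]; apply Req_le; field; lra. }
  destruct (Ceq_dec (qpoch a q K) 0) as [E|E].
  - left; exists K; intros n Hn; replace n with (K + (n - K))%nat by lia.
    rewrite qpoch_add, E; ring.
  - right.
    set (M := exp (Cmod a / (1 - Cmod q))).
    assert (HM : (0 < M)%R) by apply exp_pos.
    assert (HM1 : (1 <= M)%R).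
    { unfold M; eapply Rle_trans; [|apply exp_ineq1_le]; lra. }
    assert (HE : (0 < Cmod (qpoch a q K))%R) by (apply Cmod_gt_0, E).
    (* The 2 accounts for the tail when n >= K. The M accounts for n < K, where (a)_K = (a)_n (a
       q^n)_(K-n) and the second factor is at most M. *)
    exists (Cmod (qpoch a q K) / (2 * M))%R; split.
    { apply Rdiv_lt_0_compat; lra. }
    assert (Hdiv : (Cmod (qpoch a q K) / (2 * M) * (2 * M)
                    = Cmod (qpoch a q K))%R) by (field; lra).
    intros n; destruct (Nat.le_gt_cases K n) as [Hn|Hn].
    + replace n with (K + (n - K))%nat by lia.
      rewrite qpoch_add, Cmod_mult; specialize (HT (n - K)%nat).
      apply Rle_trans with (Cmod (qpoch a q K) * / 2)%R; [|nra].
      assert (0 < Cmod (qpoch a q K) / (2 * M))%R by (apply Rdiv_lt_0_compat; lra).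
      nra.
    + assert (E2 := qpoch_add a q n (K - n)).
      replace (n + (K - n))%nat with K in E2 by lia.
      assert (HU : (Cmod (qpoch (a * q ^ n) q (K - n)) <= M)%R).
      { eapply Rle_trans; [apply qpoch_upper, Hq|].
        destruct (Rle_lt_or_eq_dec _ _ (Cmod_mult_qpow_le a q n Hq)) as [L|L].
        - left; apply exp_increasing; apply Rmult_lt_compat_r; [|exact L].
          apply Rinv_0_lt_compat; lra.
        - right; rewrite L; reflexivity. }
      assert (E3 := f_equal Cmod E2); rewrite Cmod_mult in E3.
      pose proof (Cmod_ge_0 (qpoch a q n)).
      apply Rmult_le_reg_r with (2 * M)%R; [lra|].
      rewrite Hdiv, E3; nra.
Qed.

Lemma Clim_unshift (u : nat -> C) (l : C) : Clim (fun n => u (S n)) l -> Clim u l.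
Proof.
  intros H eps Heps; destruct (H eps Heps) as [N HN].
  exists (S N); intros [|n] Hn; [lia | apply HN; lia].
Qed.

(** Telescoping: (a)_(k+1) - (a)_k = - a q^k (a)_k is geometrically small because (a)_k is bounded.
    As [sum_n d n] includes index n, it equals (a)_(n+1) - 1, hence the shift. *)
Lemma qpoch_Clim (a q : C) :
  (Cmod q < 1)%R -> Clim (qpoch a q) (qpoch_inf a q).
Proof.
  intros Hq; pose proof (Cmod_ge_0 q) as Hq0.
  set (d := fun k => - a * q ^ k * qpoch a q k).
  assert (Hd : is_series d (CSeries d)).
  { apply (is_series_geo (Cmod a * exp (Cmod a / (1 - Cmod q))) (Cmod q));
      [lra|].
    intros k; unfold d; rewrite !Cmod_mult, Cmod_opp, Cmod_pow.
    replace (Cmod a * exp (Cmod a / (1 - Cmod q)) * Cmod q ^ k)%R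
      with (Cmod a * Cmod q ^ k * exp (Cmod a / (1 - Cmod q)))%R by ring.
    apply Rmult_le_compat_l; [|apply qpoch_upper, Hq].
    apply Rmult_le_pos; [apply Cmod_ge_0 | apply pow_le; lra]. }
  assert (H : Clim (qpoch a q) (CSeries d + 1)).
  { apply Clim_unshift, (Clim_ext (fun n => sum_n d n + 1)).
    - induction n as [|n IH].
      + rewrite sum_O; unfold d, qpoch; simpl; ring.
      + rewrite csum_S.
        change (qpoch a q (S (S n)))
          with (qpoch a q (S n) * (1 - a * q ^ S n)).
        replace (sum_n d n + d (S n) + 1) with (sum_n d n + 1 + d (S n)) by ring.
        rewrite IH; unfold d; ring.
    - apply Clim_plus; [apply is_series_Clim, Hd | apply Clim_const]. }
  unfold qpoch_inf; rewrite (Clim_CLim_seq _ _ H); exact H.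
Qed.

Lemma qpoch_inf_shift (a q : C) (n : nat) :
  (Cmod q < 1)%R -> qpoch_inf a q = qpoch a q n * qpoch_inf (a * q ^ n) q.
Proof.
  intros Hq; apply (Clim_unique (fun m => qpoch a q (n + m))).
  - apply Clim_shift, qpoch_Clim, Hq.
  - apply (Clim_ext (fun m => qpoch a q n * qpoch (a * q ^ n) q m)).
    + intros m; symmetry; apply qpoch_add.
    + apply Clim_scal, qpoch_Clim, Hq.
Qed.

Lemma qpoch_inf_neq0 (a q : C) :
  (Cmod q < 1)%R -> (forall i, a * q ^ i <> 1) -> qpoch_inf a q <> 0.
Proof.
  intros Hq Ha E; assert (HL := qpoch_Clim a q Hq); rewrite E in HL.
  destruct (qpoch_zero_or_bounded_below a q Hq) as [[K HK]|[d [Hd HB]]].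
  - apply (qpoch_neq0 a q K Ha), HK; lia.
  - destruct (HL d Hd) as [N HN]; specialize (HN N (Nat.le_refl N)).
    replace (qpoch a q N - 0) with (qpoch a q N) in HN by ring.
    specialize (HB N); lra.
Qed.

Lemma qpoch_inv_bounded (a q : C) :
  (Cmod q < 1)%R -> (forall i, a * q ^ i <> 1) ->
  exists K, (0 < K)%R /\ forall n, (Cmod (/ qpoch a q n) <= K)%R.
Proof.
  intros Hq Ha.
  destruct (qpoch_zero_or_bounded_below a q Hq) as [[K HK]|[d [Hd HB]]].
  - exfalso; apply (qpoch_neq0 a q K Ha), HK; lia.
  - exists (/ d)%R; split; [apply Rinv_0_lt_compat, Hd|].
    intros n; rewrite Cmod_inv by (apply qpoch_neq0, Ha).
    apply Rinv_le_contravar; [exact Hd | apply HB].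
Qed.

Lemma qpoch_q_inv_bounded (q : C) :
  (Cmod q < 1)%R ->
  exists K, (0 < K)%R /\ forall n, (Cmod (/ qpoch q q n) <= K)%R.
Proof.
  intros Hq; apply qpoch_inv_bounded; [exact Hq|].
  intros i; apply mult_qpow_neq1; exact Hq.
Qed.

Lemma q_binomial (A q v : C) :
  (Cmod q < 1)%R -> (Cmod v < 1)%R ->
  is_series (fun m => qpoch A q m / qpoch q q m * v ^ m)
    (qpoch_inf (A * v) q / qpoch_inf v q).
Proof.
  intros Hq Hv.
  set (c := fun m => qpoch A q m / qpoch q q m).
  destruct (qpoch_q_inv_bounded q Hq) as [K1 [HK1 HQ]].
  set (K := (exp (Cmod A / (1 - Cmod q)) * K1)%R).
  assert (Hc : forall m, (Cmod (c m) <= K)%R).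
  { intros m; unfold c, Cdiv, K; rewrite Cmod_mult.
    apply Rmult_le_compat; try apply Cmod_ge_0; [apply qpoch_upper, Hq | apply HQ]. }
  assert (HK : (0 <= K)%R) by (eapply Rle_trans; [apply Cmod_ge_0 | apply (Hc O)]).
  (* This two-term recurrence of the coefficients is the source of the functional equation of f. *)
  assert (Hc1 : forall m, c (S m) * (1 - q * q ^ m) = c m * (1 - A * q ^ m)).
  { intros m; unfold c.
    change (qpoch A q (S m)) with (qpoch A q m * (1 - A * q ^ m)).
    change (qpoch q q (S m)) with (qpoch q q m * (1 - q * q ^ m)).
    field; split; [apply qpoch_q_neq0, Hq|].
    apply Cone_minus_neq0, mult_qpow_neq1; exact Hq. }
  set (f := fun u => CSeries (fun m => c m * u ^ m)).
  assert (Hf : forall u, (Cmod u <= Cmod v)%R ->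
            Clim (sum_n (fun m => c m * u ^ m)) (f u)).
  { intros u Hu; apply is_series_Clim, (is_series_geo K (Cmod v)).
    - split; [apply Cmod_ge_0 | exact Hv].
    - intros m; rewrite Cmod_mult, Cmod_pow.
      apply Rmult_le_compat; [apply Cmod_ge_0| apply pow_le, Cmod_ge_0 | apply Hc |].
      apply pow_incr; split; [apply Cmod_ge_0 | exact Hu]. }
  (* The sum f satisfies (1 - u) f u = (1 - A u) f (u q); iterate and let u q^n -> 0. *)
  assert (Hstep : forall u, (Cmod u <= Cmod v)%R ->
            (1 - u) * f u = (1 - A * u) * f (u * q)).
  { intros u Hu.
    assert (Huq : (Cmod (u * q) <= Cmod v)%R).
    { assert (H := Cmod_mult_qpow_le u q 1 Hq); rewrite Cpow_1_r in H; lra. }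
    cut (f u - f (u * q) = u * f u - A * u * f (u * q)).
    { intros E; apply Cminus_0_eq.
      replace ((1 - u) * f u - (1 - A * u) * f (u * q))
        with ((f u - f (u * q)) - (u * f u - A * u * f (u * q))) by ring.
      rewrite E; ring. }
    (* The recurrence links [c (S m)] with [c m], so partial sums up to S n are matched with partial
       sums up to n; the two constant terms c_0 cancel. *)
    apply (Clim_unique (fun n => sum_n (fun m => c m * u ^ m) (S n)
                          + (- (1)) * sum_n (fun m => c m * (u * q) ^ m) (S n))).
    - replace (f u - f (u * q)) with (f u + (- (1)) * f (u * q)) by ring.
      apply Clim_plus; [|apply Clim_scal].
      + apply (Clim_shift 1 (sum_n (fun m => c m * u ^ m))), Hf, Hu.
      + apply (Clim_shift 1 (sum_n (fun m => c m * (u * q) ^ m))), Hf, Huq.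
    - apply (Clim_ext (fun n => u * sum_n (fun m => c m * u ^ m) n
                          + (- (A * u)) * sum_n (fun m => c m * (u * q) ^ m) n)).
      + intros n; rewrite !csum_shift.
        replace (c O * u ^ 0 + sum_n (fun k => c (S k) * u ^ S k) n
                 + (- (1)) * (c O * (u * q) ^ 0
                              + sum_n (fun k => c (S k) * (u * q) ^ S k) n))
          with (sum_n (fun k => c (S k) * u ^ S k) n
                + (- (1)) * sum_n (fun k => c (S k) * (u * q) ^ S k) n)
          by (simpl; cring).
        rewrite <- !csum_mult, <- !csum_plus; apply sum_n_ext; intros m.
        rewrite !Cpow_mult_l, !Cpow_S.
        transitivity (c (S m) * (1 - q * q ^ m) * (u * u ^ m)); [|cring].
        rewrite Hc1; cring.
      + replace (u * f u - A * u * f (u * q))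
          with (u * f u + (- (A * u)) * f (u * q)) by ring.
        apply Clim_plus; apply Clim_scal; apply Hf; assumption. }
  assert (Hiter : forall n,
            qpoch v q n * f v = qpoch (A * v) q n * f (v * q ^ n)).
  { induction n as [|n IH].
    - unfold qpoch; simpl; rewrite Cmult_1_r; reflexivity.
    - change (qpoch v q (S n)) with (qpoch v q n * (1 - v * q ^ n)).
      change (qpoch (A * v) q (S n)) with (qpoch (A * v) q n * (1 - A * v * q ^ n)).
      assert (E := Hstep (v * q ^ n) (Cmod_mult_qpow_le v q n Hq)).
      replace (qpoch v q n * (1 - v * q ^ n) * f v)
        with (qpoch v q n * f v * (1 - v * q ^ n)) by ring.
      rewrite IH, <- Cmult_assoc, (Cmult_comm (f _)), E, Cpow_S.
      replace (v * (q * q ^ n)) with (v * q ^ n * q) by ring; ring. }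
  (* Continuity of f at 0 along v q^n: termwise only the constant term c_0 = 1 survives, and K |v|^m
     dominates uniformly in n. *)
  assert (Hf1 : Clim (fun n => f (v * q ^ n)) 1).
  { set (e := fun m : nat => match m with O => RtoC 1 | S _ => RtoC 0 end).
    assert (He : CSeries e = 1).
    { apply CSeries_unique; replace (RtoC 1) with (sum_n e 0) by apply sum_O.
      apply is_series_finite; intros [|n] Hn; [lia | reflexivity]. }
    rewrite <- He.
    apply (tannery (fun n m => c m * (v * q ^ n) ^ m) e K (Cmod v)).
    - split; [apply Cmod_ge_0 | exact Hv].
    - intros n m; rewrite Cmod_mult, Cmod_pow.
      apply Rmult_le_compat; [apply Cmod_ge_0| apply pow_le, Cmod_ge_0 | apply Hc |].
      apply pow_incr; split; [apply Cmod_ge_0 | apply Cmod_mult_qpow_le, Hq].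
    - intros [|m]; simpl e.
      + apply (Clim_ext (fun _ => RtoC 1)); [|apply Clim_const].
        intros n; unfold c, qpoch; simpl; field; exact C1_nz.
      + intros eps Heps.
        destruct (pow_small K (Cmod q) eps (conj (Cmod_ge_0 q) Hq) HK Heps)
          as [N HN].
        exists N; intros n Hn; specialize (HN n Hn).
        eapply Rle_lt_trans; [|exact HN].
        replace (c (S m) * (v * q ^ n) ^ S m - 0)
          with (c (S m) * (v * q ^ n) ^ S m) by ring.
        rewrite Cmod_mult, Cmod_pow, Cmod_mult, Cmod_pow.
        apply Rmult_le_compat; [apply Cmod_ge_0| | apply Hc |].
        { apply pow_le, Rmult_le_pos; [|apply pow_le]; apply Cmod_ge_0. }
        pose proof (Cmod_ge_0 v); pose proof (pow_le (Cmod q) n (Cmod_ge_0 q)).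
        assert (Hqn : (Cmod q ^ n <= 1)%R).
        { rewrite <- (pow1 n); apply pow_incr; split; [apply Cmod_ge_0 | lra]. }
        assert (Hm : ((Cmod v * Cmod q ^ n) ^ m <= 1)%R).
        { rewrite <- (pow1 m); apply pow_incr; split;
            [apply Rmult_le_pos; assumption|].
          rewrite <- (Rmult_1_r 1); apply Rmult_le_compat; lra. }
        assert (Hm0 : (0 <= (Cmod v * Cmod q ^ n) ^ m)%R)
          by (apply pow_le, Rmult_le_pos; assumption).
        rewrite <- tech_pow_Rmult.
        apply Rle_trans with (1 * Cmod q ^ n * 1)%R; [|lra].
        apply Rmult_le_compat; try assumption; [apply Rmult_le_pos; assumption|].
        apply Rmult_le_compat_r; lra. }
  assert (Hv0 : qpoch_inf v q <> 0).
  { apply qpoch_inf_neq0; [exact Hq | intros i; apply mult_qpow_neq1; assumption]. }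
  cut (qpoch_inf v q * f v = qpoch_inf (A * v) q * 1).
  { intros E; replace (qpoch_inf (A * v) q / qpoch_inf v q) with (f v).
    - apply is_series_Clim, (Hf v (Rle_refl _)).
    - rewrite Cmult_1_r in E; rewrite <- E; field; exact Hv0. }
  apply (Clim_unique (fun n => qpoch v q n * f v)).
  - apply Clim_mult; [apply qpoch_Clim, Hq | apply Clim_const].
  - apply (Clim_ext (fun n => qpoch (A * v) q n * f (v * q ^ n))).
    + intros n; symmetry; apply Hiter.
    + apply Clim_mult; [apply qpoch_Clim, Hq | exact Hf1].
Qed.

(** * Powers of q and the q-Vandermonde identity *)

Lemma Cexp_plus (a b : C) : Cexp (a + b) = Cexp a * Cexp b.
Proof.
  unfold Cexp; destruct a as [a1 a2]; destruct b as [b1 b2].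
  apply injective_projections; simpl; rewrite exp_plus, ?cos_plus, ?sin_plus; ring.
Qed.

Lemma Cmod_Cexp (z : C) : Cmod (Cexp z) = exp (Re z).
Proof.
  unfold Cexp, Cmod; simpl fst; simpl snd.
  replace ((exp (Re z) * cos (Im z)) ^ 2 + (exp (Re z) * sin (Im z)) ^ 2)%R
    with (exp (Re z) ^ 2 * (Rsqr (sin (Im z)) + Rsqr (cos (Im z))))%R
    by (unfold Rsqr; ring).
  rewrite sin2_cos2, Rmult_1_r; apply sqrt_pow2; left; apply exp_pos.
Qed.

Lemma Cexp_0 : Cexp 0 = 1.
Proof.
  unfold Cexp; simpl; rewrite exp_0, cos_0, sin_0.
  apply injective_projections; simpl; ring.
Qed.

Lemma qpow_plus (lq a b : C) : qpow lq (a + b) = qpow lq a * qpow lq b.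
Proof. unfold qpow; rewrite <- Cexp_plus; f_equal; ring. Qed.

Lemma qpow_0 (lq : C) : qpow lq 0 = 1.
Proof. unfold qpow; rewrite Cmult_0_l; apply Cexp_0. Qed.

Lemma qpow_INR (q lq : C) (n : nat) :
  Cexp lq = q -> qpow lq (INR n) = q ^ n.
Proof.
  intros Hq; induction n as [|n IH]; [apply qpow_0|].
  rewrite S_INR, RtoC_plus, qpow_plus, IH, Cpow_S.
  unfold qpow; rewrite Cmult_1_l, Hq; ring.
Qed.

(** The Gaussian binomial coefficient, meaningful only for k <= n: beyond that, the truncated n - k
    leaves (q)_n / (q)_k instead of 0. *)
Definition gbin (q : C) (n k : nat) : C :=
  qpoch q q n / (qpoch q q k * qpoch q q (n - k)).

Lemma qpoch_S (a q : C) (n : nat) :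
  qpoch a q (S n) = qpoch a q n * (1 - a * q ^ n).
Proof. reflexivity. Qed.

Lemma qbin_INR (q lq : C) (n k : nat) :
  (Cmod q < 1)%R -> Cexp lq = q -> (k <= n)%nat ->
  qbin q lq (INR n) k = gbin q n k.
Proof.
  intros Hq Hlq Hk.
  (* With the denominators cleared, the step from k to k + 1 trades the last factor 1 - q^(n-k) of
     (q)_(n-k) for - (1 - q^(k-n)) q^(n-k), which is the same number; the exponent grows by n - k
     accordingly. *)
  assert (H : qpoch (qpow lq (- INR n)) q k * (- 1) ^ k
              * qpow lq (INR n * INR k - binom2 k) * qpoch q q (n - k)
              = qpoch q q n).
  { induction k as [|k IH].
    - rewrite Nat.sub_0_r; unfold qpoch at 1; simpl.
      replace (binom2 0) with 0%R by (unfold binom2; simpl; lra).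
      replace (INR n * 0 - 0) with (RtoC 0) by ring.
      rewrite qpow_0; ring.
    - rewrite <- IH by lia.
      replace (n - k)%nat with (S (n - S k)) by lia.
      rewrite !qpoch_S, Cpow_S.
      replace (INR n * INR (S k) - binom2 (S k))
        with (INR n * INR k - binom2 k + INR (n - k)).
      + rewrite qpow_plus, (qpow_INR q lq (n - k) Hlq).
        assert (E : qpow lq (- INR n) * q ^ k * q ^ (n - k) = 1).
        { rewrite <- Cmult_assoc, <- Cpow_add_r.
          replace (k + (n - k))%nat with n by lia.
          rewrite <- (qpow_INR q lq n Hlq), <- qpow_plus, <- (qpow_0 lq).
          f_equal; ring. }
        replace (n - k)%nat with (S (n - S k)) in * by lia.
        rewrite Cpow_S in *.
        set (X := qpow lq (- INR n) * q ^ k) in *.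
        set (Y := q * q ^ (n - S k)) in *.
        replace (1 - Y) with (X * Y - Y) by (rewrite E; reflexivity).
        ring.
      + rewrite minus_INR by lia; unfold binom2; rewrite S_INR.
        rewrite <- !RtoC_mult, <- !RtoC_minus, <- RtoC_plus.
        f_equal; field. }
  unfold qbin, gbin; rewrite <- H; field.
  split; apply qpoch_q_neq0, Hq.
Qed.

Lemma gbin_0 (q : C) (n : nat) : (Cmod q < 1)%R -> gbin q n 0 = 1.
Proof.
  intros Hq; unfold gbin; rewrite Nat.sub_0_r; unfold qpoch at 2; simpl.
  field; apply qpoch_q_neq0, Hq.
Qed.

Lemma gbin_diag (q : C) (n : nat) : (Cmod q < 1)%R -> gbin q n n = 1.
Proof.
  intros Hq; unfold gbin; rewrite Nat.sub_diag; unfold qpoch at 3; simpl.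
  field; apply qpoch_q_neq0, Hq.
Qed.

Lemma gbin_pascal (q : C) (n k : nat) :
  (Cmod q < 1)%R -> (k < n)%nat ->
  gbin q (S n) (S k) = gbin q n (S k) + q ^ (n - k) * gbin q n k.
Proof.
  intros Hq Hk; unfold gbin.
  replace (S n - S k)%nat with (n - k)%nat by lia.
  assert (Hn : n = (k + S (n - S k))%nat) by lia.
  set (d := (n - S k)%nat) in *.
  replace (n - k)%nat with (S d) by lia.
  rewrite !qpoch_S.
  replace (q ^ n) with (q ^ k * (q * q ^ d))
    by (rewrite Hn, Cpow_add_r; reflexivity).
  rewrite Cpow_S.
  field; repeat split; try (apply qpoch_q_neq0, Hq);
    apply Cone_minus_neq0, mult_qpow_neq1; exact Hq.
Qed.

(** Pascal's rule tested against an arbitrary f: raising n by one amounts to changing f, which is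
    the form that the induction in [q_vandermonde] consumes. *)
Lemma gbin_sum_succ (q : C) (n : nat) (f : nat -> C) :
  (Cmod q < 1)%R ->
  sum_n (fun k => gbin q (S n) k * f k) (S n)
  = sum_n (fun k => gbin q n k * (f k + q ^ (n - k) * f (S k))) n.
Proof.
  intros Hq.
  (* The two halves of Pascal's rule, extended by 0 at the ends; [a] is cut at k = S n because
     [gbin q n (S n)] does not vanish. *)
  set (a := fun k => if Nat.leb k n then gbin q n k * f k else RtoC 0).
  set (b := fun k => match k with O => RtoC 0
                     | S i => gbin q n i * (q ^ (n - i) * f (S i)) end).
  transitivity (sum_n (fun k => a k + b k) (S n)).
  { apply sum_n_ext_loc; intros k Hk; unfold a, b.
    destruct (Nat.leb_spec k n) as [Hkn|Hkn].
    - destruct k as [|k]; [rewrite !gbin_0 by exact Hq; cring|].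
      rewrite gbin_pascal by (exact Hq || lia); cring.
    - replace k with (S n) by lia.
      rewrite Nat.sub_diag, !gbin_diag by exact Hq; simpl; cring. }
  rewrite csum_plus, csum_S, (csum_shift b).
  replace (a (S n)) with (RtoC 0)
    by (unfold a; destruct (Nat.leb_spec (S n) n); [lia | reflexivity]).
  transitivity (sum_n a n + sum_n (fun k => b (S k)) n); [simpl; cring|].
  rewrite <- csum_plus; apply sum_n_ext_loc; intros k Hk; unfold a, b.
  destruct (Nat.leb_spec k n); [cring | lia].
Qed.

(** Induction on n with f varying. The new weight q^(n+m-k) at k = i + j splits into q^(n-i), which
    Pascal's rule for n absorbs, and q^(m-j), which turns q^(i(m-j)) into q^((i+1)(m-j)). *)
Lemma q_vandermonde (q : C) (n m : nat) (f : nat -> C) :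
  (Cmod q < 1)%R ->
  sum_n (fun k => gbin q (n + m) k * f k) (n + m)
  = sum_n (fun i => sum_n (fun j =>
      gbin q n i * gbin q m j * q ^ (i * (m - j)) * f (i + j)%nat) m) n.
Proof.
  intros Hq; revert f; induction n as [|n IH]; intros f.
  - rewrite sum_O; apply sum_n_ext; intros j; simpl.
    rewrite gbin_diag by exact Hq; cring.
  - change (S n + m)%nat with (S (n + m)).
    rewrite gbin_sum_succ by exact Hq.
    rewrite (IH (fun k => f k + q ^ (n + m - k) * f (S k))).
    rewrite (sum_n_switch (G := C_AbelianMonoid)
      (fun i j => gbin q (S n) i * gbin q m j * q ^ (i * (m - j)) * f (i + j)%nat)).
    rewrite (sum_n_switch (G := C_AbelianMonoid)).
    apply sum_n_ext_loc; intros j Hj.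
    transitivity (sum_n (fun i => gbin q (S n) i *
      (gbin q m j * q ^ (i * (m - j)) * f (i + j)%nat)) (S n));
      [|apply sum_n_ext; intros i; cring].
    rewrite gbin_sum_succ by exact Hq.
    apply sum_n_ext_loc; intros i Hi.
    replace (n + m - (i + j))%nat with ((n - i) + (m - j))%nat by lia.
    replace (S i * (m - j))%nat with ((m - j) + i * (m - j))%nat by lia.
    rewrite !Cpow_add_r; simpl; cring.
Qed.

(** * Geometric decay *)

Lemma geo_le_mono (K K' th th' : R) (u : nat -> C) :
  (0 <= th <= th')%R -> (K <= K')%R -> geo_le K th u -> geo_le K' th' u.
Proof.
  intros Hth HK Hu n; assert (H0 := geo_le_pos _ _ _ Hu).
  eapply Rle_trans; [apply Hu|].
  apply Rmult_le_compat; [exact H0 | apply pow_le; lra | exact HK |].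
  apply pow_incr; exact Hth.
Qed.

Lemma geo_le_eventually (K th : R) (N : nat) (u : nat -> C) :
  (0 < th)%R -> (forall n, (N <= n)%nat -> (Cmod (u n) <= K * th ^ n)%R) ->
  exists K', geo_le K' th u.
Proof.
  intros Hth; revert K; induction N as [|N IH]; intros K H.
  - exists K; intros n; apply H; lia.
  - apply (IH (Rmax K (Cmod (u N) / th ^ N))); intros n Hn.
    assert (Hp : (0 < th ^ n)%R) by (apply pow_lt, Hth).
    destruct (Nat.eq_dec n N) as [->|Hne].
    + apply Rle_trans with (Cmod (u N) / th ^ N * th ^ N)%R.
      * apply Req_le; field; lra.
      * apply Rmult_le_compat_r; [lra | apply Rmax_r].
    + eapply Rle_trans; [apply H; lia|].
      apply Rmult_le_compat_r; [lra | apply Rmax_l].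
Qed.

Lemma geo_le_of_eventually_0 (N : nat) (u : nat -> C) :
  (forall n, (N <= n)%nat -> u n = 0) ->
  exists K th, (0 <= th < 1)%R /\ geo_le K th u.
Proof.
  intros H; destruct (geo_le_eventually 0 (/ 2) N u ltac:(lra)) as [K HK].
  - intros n Hn; rewrite H by exact Hn; rewrite Cmod_0; lra.
  - exists K, (/ 2)%R; split; [lra | exact HK].
Qed.

Lemma exp_INR_mult (n : nat) (a : R) : exp (INR n * a) = (exp a ^ n)%R.
Proof.
  induction n as [|n IH]; [simpl; rewrite Rmult_0_l; apply exp_0|].
  rewrite S_INR, Rmult_plus_distr_r, exp_plus, IH, Rmult_1_l; simpl; ring.
Qed.

(** Terms below 1 mean A + n D < 0 for all large n. This excludes D > 0, so A + n D never increases
    and its exponential at [S N] bounds all later ratios. *)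
Lemma exp_quadratic_decay (A D : R) (N : nat) :
  (forall n, (N <= n)%nat -> (exp (INR n * (A + INR n * D)) < 1)%R) ->
  exists th N', (0 < th < 1)%R /\
    forall n, (N' <= n)%nat -> (exp (INR n * (A + INR n * D)) <= th ^ n)%R.
Proof.
  intros H.
  assert (Hneg : forall n, (S N <= n)%nat -> (A + INR n * D < 0)%R).
  { intros n Hn; apply Rnot_le_lt; intros Hle.
    specialize (H n ltac:(lia)).
    assert (H1 := exp_ineq1_le (INR n * (A + INR n * D))).
    assert (0 <= INR n * (A + INR n * D))%R by (apply Rmult_le_pos; [apply pos_INR | exact Hle]).
    lra. }
  assert (HD : (D <= 0)%R).
  { apply Rnot_lt_le; intros HD.
    destruct (INR_unbounded (Rabs A / D)) as [m Hm].
    assert (Hm2 := Hneg (m + S N)%nat ltac:(lia)).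
    rewrite plus_INR in Hm2.
    assert (Hx : (Rabs A < INR m * D)%R).
    { replace (Rabs A) with (Rabs A / D * D)%R by (field; lra).
      apply Rmult_lt_compat_r; lra. }
    assert (0 <= INR (S N) * D)%R by (apply Rmult_le_pos; [apply pos_INR | lra]).
    assert (H3 := Rle_abs (- A)); rewrite Rabs_Ropp in H3; nra. }
  exists (exp (A + INR (S N) * D)), (S N); split.
  - split; [apply exp_pos|]; rewrite <- exp_0.
    apply exp_increasing, Hneg; lia.
  - intros n Hn; rewrite exp_INR_mult; apply pow_incr; split; [left; apply exp_pos|].
    apply le_INR in Hn.
    assert (Hle : (A + INR n * D <= A + INR (S N) * D)%R) by nra.
    destruct Hle as [Hlt|Heq]; [left; apply exp_increasing, Hlt | rewrite Heq; apply Rle_refl].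
Qed.

(** * Decay of the coefficients and of the 2Phi1 terms *)

Definition kexp (alpha : C) (r s : R) (k : nat) : C :=
  INR k * alpha + r * binom2 k - s * binom2 (S k).

Lemma Cmod_qpow_kexp (lq alpha : C) (r s : R) (k : nat) :
  Cmod (qpow lq (kexp alpha r s k))
  = exp (INR k * ((Re (alpha * lq) - (r + s) / 2 * Re lq)
                  + INR k * ((r - s) / 2 * Re lq))).
Proof.
  unfold qpow; rewrite Cmod_Cexp; f_equal.
  unfold kexp, binom2; rewrite S_INR.
  destruct alpha as [a1 a2]; destruct lq as [l1 l2]; simpl; field.
Qed.

Lemma ex_series_abs_lim0 (u : nat -> C) (d : R) :
  ex_series_abs u -> (0 < d)%R ->
  exists N, forall n, (N <= n)%nat -> (Cmod (u n) < d)%R.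
Proof.
  intros H Hd; apply ex_series_lim_0, is_lim_seq_spec in H.
  destruct (H (mkposreal d Hd)) as [N HN]; exists N; intros n Hn.
  specialize (HN n Hn); simpl in HN.
  rewrite Rminus_0_r, Rabs_pos_eq in HN by apply Cmod_ge_0; exact HN.
Qed.

Lemma Copp_q_pow_neq1 (q : C) (i : nat) : (Cmod q < 1)%R -> - q * q ^ i <> 1.
Proof. intros Hq; apply mult_qpow_neq1; [exact Hq | rewrite Cmod_opp; exact Hq]. Qed.

(* Mere boundedness would not do: when |t| = |w| the inner sum over j costs a
   factor k + 1, so summability must be upgraded to geometric decay. *)
Lemma kfactor_geo (q lq alpha a u : C) (r s : R) :
  (Cmod q < 1)%R ->
  ex_series_abs (fun k => kfactor q lq alpha a (kexp alpha r s k) u k) ->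
  exists K th, (0 <= th < 1)%R /\
    geo_le K th (fun k => kfactor q lq alpha a (kexp alpha r s k) u k).
Proof.
  intros Hq Hs.
  set (b := - qpow lq (- alpha)).
  (* In three degenerate cases, u = 0 or one of the numerator factorials eventually 0, the terms
     vanish from some index on. Otherwise |u|^k can be absorbed as ln |u| into the linear
     coefficient [A]. *)
  destruct (Ceq_dec u 0) as [->|Hu].
  { apply (geo_le_of_eventually_0 1); intros [|n] Hn; [lia|].
    unfold kfactor; rewrite Cpow_S; unfold Cdiv; ring. }
  destruct (qpoch_zero_or_bounded_below b q Hq) as [[N HN]|[d1 [Hd1 HB1]]].
  { apply (geo_le_of_eventually_0 N); intros n Hn.
    unfold kfactor, qpoch2; fold b; rewrite (HN n Hn); unfold Cdiv; ring. }
  destruct (qpoch_zero_or_bounded_below a q Hq) as [[N HN]|[d2 [Hd2 HB2]]].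
  { apply (geo_le_of_eventually_0 N); intros n Hn.
    unfold kfactor, qpoch2; rewrite (HN n Hn); unfold Cdiv; ring. }
  assert (Hu0 : (0 < Cmod u)%R) by (apply Cmod_gt_0, Hu).
  set (A := (Re (alpha * lq) - (r + s) / 2 * Re lq + ln (Cmod u))%R).
  set (D := ((r - s) / 2 * Re lq)%R).
  assert (HM : forall k, Cmod (kfactor q lq alpha a (kexp alpha r s k) u k)
     = (exp (INR k * (A + INR k * D))
        * (Cmod (qpoch b q k) * Cmod (qpoch a q k) * Cmod (/ qpoch (- q) q k)))%R).
  { intros k; unfold kfactor, qpoch2, Cdiv; fold b.
    rewrite !Cmod_mult, Cmod_qpow_kexp, Cmod_pow.
    rewrite <- (exp_ln (Cmod u) Hu0) at 1; rewrite <- exp_INR_mult.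
    fold D.
    replace (INR k * (A + INR k * D))%R
      with (INR k * (Re (alpha * lq) - (r + s) / 2 * Re lq + INR k * D)
            + INR k * ln (Cmod u))%R by (unfold A; ring).
    rewrite exp_plus; ring. }
  set (d3 := (/ exp (Cmod (- q) / (1 - Cmod q)))%R).
  assert (Hd3 : (0 < d3)%R) by apply Rinv_0_lt_compat, exp_pos.
  assert (HB3 : forall k, (d3 <= Cmod (/ qpoch (- q) q k))%R).
  { intros k; assert (Hnz : qpoch (- q) q k <> 0)
      by (apply qpoch_neq0; intros i; apply Copp_q_pow_neq1, Hq).
    rewrite Cmod_inv by exact Hnz.
    apply Rinv_le_contravar; [apply Cmod_gt_0, Hnz | apply qpoch_upper, Hq]. }
  destruct (qpoch_inv_bounded (- q) q Hq) as [K3 [HK3 HU3]].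
  { intros i; apply Copp_q_pow_neq1, Hq. }
  assert (Hd : (0 < d1 * d2 * d3)%R)
    by (repeat apply Rmult_lt_0_compat; assumption).
  (* The terms of a convergent series eventually drop below the lower bound d1 d2 d3 of the
     non-exponential factor, so the exponential factor itself drops below 1. *)
  destruct (ex_series_abs_lim0 _ _ Hs Hd) as [N HN].
  destruct (exp_quadratic_decay A D N) as [th [N' [Hth Hdec]]].
  { intros n Hn; specialize (HN n Hn); rewrite HM in HN.
    apply Rnot_le_lt; intros Hle; apply (Rlt_irrefl (d1 * d2 * d3)%R).
    eapply Rle_lt_trans; [|exact HN].
    rewrite <- (Rmult_1_l (d1 * d2 * d3)).
    apply Rmult_le_compat; [lra | lra | exact Hle |].
    apply Rmult_le_compat; [|lra| |apply HB3].
    - apply Rmult_le_pos; lra.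
    - apply Rmult_le_compat; [lra | lra | apply HB1 | apply HB2]. }
  set (K1 := exp (Cmod b / (1 - Cmod q))).
  set (K2 := exp (Cmod a / (1 - Cmod q))).
  destruct (geo_le_eventually (K1 * K2 * K3) th N'
              (fun k => kfactor q lq alpha a (kexp alpha r s k) u k)) as [K HK].
  - lra.
  - intros n Hn; rewrite HM, Rmult_comm.
    apply Rmult_le_compat; [| left; apply exp_pos | | apply Hdec, Hn].
    + repeat apply Rmult_le_pos; apply Cmod_ge_0.
    + repeat apply Rmult_le_compat; try apply Rmult_le_pos; try apply Cmod_ge_0;
        [apply qpoch_upper, Hq | apply qpoch_upper, Hq | apply HU3].
  - exists K, th; split; [lra | exact HK].
Qed.

Lemma qpoch_pow_geo (c q v : C) :
  (Cmod q < 1)%R -> (Cmod v < 1)%R ->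
  exists K th, (0 <= th < 1)%R /\ geo_le K th (fun i => qpoch c q i * v ^ i).
Proof.
  intros Hq Hv; exists (exp (Cmod c / (1 - Cmod q))), (Cmod v); split.
  - split; [apply Cmod_ge_0 | exact Hv].
  - intros i; rewrite Cmod_mult, Cmod_pow; apply Rmult_le_compat_r.
    + apply pow_le, Cmod_ge_0.
    + apply qpoch_upper, Hq.
Qed.

Lemma qpoch_0 (q : C) (n : nat) : qpoch 0 q n = 1.
Proof. induction n as [|n IH]; [reflexivity|]; rewrite qpoch_S, IH; ring. Qed.

(* Either the series terminates, in which case |v| >= 1 is possible, or |v| < 1. *)
Lemma phi21_abs_geo (c b q v : C) :
  (Cmod q < 1)%R -> (forall i, b * q ^ i <> 1) ->
  ex_series_abs (phi21_term c 0 b q v) ->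
  exists K th, (0 <= th < 1)%R /\ geo_le K th (fun i => qpoch c q i * v ^ i).
Proof.
  intros Hq Hb Hs.
  destruct (qpoch_zero_or_bounded_below c q Hq) as [[N HN]|[d [Hd HB]]].
  { apply (geo_le_of_eventually_0 N); intros n Hn; rewrite HN by exact Hn; ring. }
  apply qpoch_pow_geo; [exact Hq|].
  (* If |v| >= 1, every term would have modulus at least d / (K1 K2), so the terms could not tend to
     0. *)
  apply Rnot_le_lt; intros Hv.
  set (K1 := exp (Cmod b / (1 - Cmod q))).
  set (K2 := exp (Cmod q / (1 - Cmod q))).
  assert (HK1 : (0 < K1)%R) by apply exp_pos.
  assert (HK2 : (0 < K2)%R) by apply exp_pos.
  assert (Hp : (0 < d * / K1 * / K2)%R)
    by (repeat apply Rmult_lt_0_compat; try apply Rinv_0_lt_compat; assumption).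
  destruct (ex_series_abs_lim0 _ _ Hs Hp) as [N HN].
  specialize (HN N (Nat.le_refl N)).
  apply (Rlt_irrefl (d * / K1 * / K2)%R).
  eapply Rle_lt_trans; [|exact HN].
  unfold phi21_term, qpoch2, Cdiv; rewrite qpoch_0, Cmult_1_r.
  rewrite !Cmod_mult, Cmod_pow.
  assert (Hbn : qpoch b q N <> 0) by (apply qpoch_neq0, Hb).
  assert (Hqn : qpoch q q N <> 0) by (apply qpoch_q_neq0, Hq).
  rewrite !Cmod_inv by assumption.
  assert (Hinv : forall x y : R, (0 < x <= y)%R -> (0 < / y <= / x)%R).
  { intros x y Hxy; split; [apply Rinv_0_lt_compat; lra|].
    apply Rinv_le_contravar; lra. }
  destruct (Hinv (Cmod (qpoch b q N)) K1) as [I1 I2].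
  { split; [apply Cmod_gt_0, Hbn | apply qpoch_upper, Hq]. }
  destruct (Hinv (Cmod (qpoch q q N)) K2) as [I3 I4].
  { split; [apply Cmod_gt_0, Hqn | apply qpoch_upper, Hq]. }
  assert (Hv1 : (1 <= Cmod v ^ N)%R) by (apply pow_R1_Rle, Hv).
  apply Rmult_le_compat; [|lra| |].
  - apply Rmult_le_pos; lra.
  - apply Rmult_le_compat; [lra | lra | apply HB | exact I2].
  - rewrite <- (Rmult_1_l (/ K2)); apply Rmult_le_compat; lra.
Qed.

(* Interpolates between the pure powers of the larger of [t] and [w]. *)
Lemma geo_le_mixed (K th : R) (a : nat -> C) (t w : C) :
  geo_le K th (fun k => a k * t ^ k) -> geo_le K th (fun k => a k * w ^ k) ->
  forall i j, (Cmod (a (i + j)%nat * (t ^ i * w ^ j)) <= K * th ^ (i + j))%R.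
Proof.
  intros Ht Hw i j; rewrite !Cmod_mult, !Cmod_pow.
  pose proof (Cmod_ge_0 t); pose proof (Cmod_ge_0 w).
  destruct (Rle_dec (Cmod t) (Cmod w)) as [Hle|Hle].
  - eapply Rle_trans; [|apply Hw].
    rewrite Cmod_mult, Cmod_pow; apply Rmult_le_compat_l; [apply Cmod_ge_0|].
    rewrite pow_add; apply Rmult_le_compat_r; [apply pow_le; assumption|].
    apply pow_incr; lra.
  - eapply Rle_trans; [|apply Ht].
    rewrite Cmod_mult, Cmod_pow; apply Rmult_le_compat_l; [apply Cmod_ge_0|].
    rewrite pow_add; apply Rmult_le_compat_l; [apply pow_le; assumption|].
    apply pow_incr; lra.
Qed.

(** * The rearrangement *)

Section Double_sum.

(** Here c stands for y / x, so c (x w) is y w, and [Hyw] keeps the denominators nonzero. Of [kap]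
    the rearrangement sees only its decay against t^k and w^k. *)
Context (q c x t w : C) (kap : nat -> C) (K1 K2 th : R).
Context (Hq : (Cmod q < 1)%R) (Hw : w <> 0) (Hxw : (Cmod (x * w) < 1)%R)
  (Hyw : forall i, c * (x * w) * q ^ i <> 1) (Hth : (0 <= th < 1)%R)
  (Hkt : geo_le K1 th (fun k => kap k * t ^ k))
  (Hkw : geo_le K1 th (fun k => kap k * w ^ k))
  (Hpt : geo_le K2 th (fun i => qpoch c q i * (x * t) ^ i))
  (Hpw : geo_le K2 th (fun i => qpoch c q i * (x * w) ^ i)).

Let pl (i : nat) : C := qpoch c q i * x ^ i.

Let term (i j l m : nat) : C :=
  kap (i + j)%nat * (t ^ i * w ^ j) / (qpoch q q i * qpoch q q j)
  * (pl (l + m)%nat * (t ^ l * w ^ m) / (qpoch q q l * qpoch q q m))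
  * q ^ (i * m).

Let genpoly (n : nat) : C :=
  sum_n (fun k => gbin q n k * (kap k * pl (n - k)%nat)) n.

Let b : C := c * (x * w).

Let phi (j : nat) : C := phi21 c 0 (b * q ^ j) q (x * t).

Let cst : C := qpoch_inf b q / qpoch_inf (x * w) q.

Let xw_neq1 (i : nat) : x * w * q ^ i <> 1.
Proof. apply mult_qpow_neq1; assumption. Qed.

Let qq_neq0 (n : nat) : qpoch q q n <> 0.
Proof. apply qpoch_q_neq0, Hq. Qed.

Lemma term_bound :
  exists K, forall i j l m,
    (Cmod (term i j l m) <= K * th ^ i * th ^ j * th ^ l * th ^ m)%R.
Proof.
  destruct (qpoch_q_inv_bounded q Hq) as [M [HM HQ]].
  assert (Hpt' : geo_le K2 th (fun i => pl i * t ^ i)).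
  { intros i; eapply Rle_trans; [|apply (Hpt i)]; apply Req_le; f_equal.
    unfold pl; rewrite Cpow_mult_l; ring. }
  assert (Hpw' : geo_le K2 th (fun i => pl i * w ^ i)).
  { intros i; eapply Rle_trans; [|apply (Hpw i)]; apply Req_le; f_equal.
    unfold pl; rewrite Cpow_mult_l; ring. }
  assert (B1 := geo_le_mixed K1 th kap t w Hkt Hkw).
  assert (B2 := geo_le_mixed K2 th pl t w Hpt' Hpw').
  exists (K1 * (M * M) * (K2 * (M * M)))%R; intros i j l m.
  assert (Hqi : (Cmod (q ^ (i * m)) <= 1)%R).
  { rewrite Cmod_pow, <- (pow1 (i * m)); apply pow_incr.
    split; [apply Cmod_ge_0 | lra]. }
  assert (Hinv : forall u v, (Cmod (/ (qpoch q q u * qpoch q q v)) <= M * M)%R).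
  { intros u v.
    replace (/ (qpoch q q u * qpoch q q v)) with (/ qpoch q q u * / qpoch q q v)
      by (field; auto).
    rewrite Cmod_mult; apply Rmult_le_compat; try apply Cmod_ge_0; apply HQ. }
  replace (K1 * (M * M) * (K2 * (M * M)) * th ^ i * th ^ j * th ^ l * th ^ m)%R
    with (K1 * th ^ (i + j) * (M * M) * (K2 * th ^ (l + m) * (M * M)) * 1)%R
    by (rewrite !pow_add; ring).
  unfold term, Cdiv; rewrite (Cmod_mult _ (q ^ (i * m))).
  apply Rmult_le_compat; [apply Cmod_ge_0 | apply Cmod_ge_0 | | exact Hqi].
  rewrite Cmod_mult; apply Rmult_le_compat; try apply Cmod_ge_0;
    rewrite Cmod_mult; apply Rmult_le_compat; try apply Cmod_ge_0; auto.
Qed.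

(** As (c)_(l+m) = (c)_l (c q^l)_m, the sum over m is a q-binomial series with parameter c q^l and
    argument x w q^i. Shifting the infinite products back to b and x w leaves (x w)_i / (b)_i and
    the denominator (b q^i)_l of the 2Phi1. *)
Lemma term_sum_m (i j l : nat) :
  CSeries (term i j l)
  = kap (i + j)%nat * (t ^ i * w ^ j) / (qpoch q q i * qpoch q q j)
    * (cst * (qpoch (x * w) q i / qpoch b q i)
       * phi21_term c 0 (b * q ^ i) q (x * t) l).
Proof.
  assert (Hv : (Cmod (x * w * q ^ i) < 1)%R).
  { eapply Rle_lt_trans; [apply Cmod_mult_qpow_le, Hq | exact Hxw]. }
  assert (Hs := q_binomial (c * q ^ l) q (x * w * q ^ i) Hq Hv).
  set (pre := kap (i + j)%nat * (t ^ i * w ^ j) / (qpoch q q i * qpoch q q j)).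
  assert (Hbn : forall n, qpoch b q n <> 0) by (intros n; apply qpoch_neq0, Hyw).
  assert (Hbin : qpoch (b * q ^ i) q l <> 0).
  { apply qpoch_neq0; intros k; rewrite <- Cmult_assoc, <- Cpow_add_r; apply Hyw. }
  assert (Hxwi : qpoch_inf (x * w) q <> 0) by (apply qpoch_inf_neq0; auto).
  assert (Hxwin : qpoch_inf (x * w * q ^ i) q <> 0).
  { apply qpoch_inf_neq0; [exact Hq|]; intros k.
    rewrite <- Cmult_assoc, <- Cpow_add_r; apply xw_neq1. }
  assert (Hxwn : qpoch (x * w) q i <> 0) by (apply qpoch_neq0; auto).
  transitivity (pre * (qpoch c q l * (x * t) ^ l / qpoch q q l)
    * (qpoch_inf (c * q ^ l * (x * w * q ^ i)) q / qpoch_inf (x * w * q ^ i) q)).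
  - apply CSeries_unique.
    eapply is_series_ext; [|apply is_series_scal_C, Hs].
    intros m; unfold term; fold pre; unfold pl; simpl.
    rewrite qpoch_add, !Cpow_mult_l, <- Cpow_mult_r, Cpow_add_r.
    match goal with |- @eq _ ?a ?b => change (@eq C a b) end.
    field; split; apply qq_neq0.
  - replace (c * q ^ l * (x * w * q ^ i)) with (b * q ^ i * q ^ l)
      by (unfold b; ring).
    unfold cst, phi21_term, qpoch2; rewrite qpoch_0, Cmult_1_r.
    rewrite (qpoch_inf_shift (x * w) q i Hq).
    rewrite (qpoch_inf_shift b q i Hq), (qpoch_inf_shift (b * q ^ i) q l Hq).
    field; repeat split; auto.
Qed.

Lemma phi21_term_series (j : nat) :
  is_series (phi21_term c 0 (b * q ^ j) q (x * t)) (phi j).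
Proof.
  assert (Hb : forall i, b * q ^ j * q ^ i <> 1).
  { intros i; rewrite <- Cmult_assoc, <- Cpow_add_r; apply Hyw. }
  destruct (qpoch_inv_bounded (b * q ^ j) q Hq Hb) as [M1 [HM1 HB1]].
  destruct (qpoch_q_inv_bounded q Hq) as [M2 [HM2 HB2]].
  apply (is_series_geo (M1 * M2 * K2) th); [exact Hth|].
  intros n; unfold phi21_term, qpoch2; rewrite qpoch_0, Cmult_1_r.
  replace (qpoch c q n / qpoch (b * q ^ j) q n * ((x * t) ^ n / qpoch q q n))
    with (/ qpoch (b * q ^ j) q n * / qpoch q q n * (qpoch c q n * (x * t) ^ n))
    by (field; split; [apply qq_neq0 | apply qpoch_neq0, Hb]).
  rewrite Cmod_mult, Rmult_assoc.
  apply Rmult_le_compat; try apply Cmod_ge_0; [|apply Hpt].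
  rewrite Cmod_mult; apply Rmult_le_compat; auto; apply Cmod_ge_0.
Qed.

(** Writing t^i w^j as w^(i+j) (t/w)^i prepares the grouping by k = i + j; the index i here becomes
    the inner index j of the final double sum. *)
Lemma term_sum_lm (i j : nat) :
  CSeries (fun l => CSeries (term i j l))
  = cst * (kap (i + j)%nat * w ^ (i + j) / qpoch q q j
           * (qpoch (x * w) q i * (t / w) ^ i / qpoch2 b q q i) * phi i).
Proof.
  assert (Hbn : qpoch b q i <> 0) by (apply qpoch_neq0, Hyw).
  apply CSeries_unique.
  eapply is_series_ext; [intros l; symmetry; apply term_sum_m|].
  replace (cst * (kap (i + j)%nat * w ^ (i + j) / qpoch q q j
           * (qpoch (x * w) q i * (t / w) ^ i / qpoch2 b q q i) * phi i))
    with (kap (i + j)%nat * (t ^ i * w ^ j) / (qpoch q q i * qpoch q q j)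
          * (cst * (qpoch (x * w) q i / qpoch b q i)) * phi i).
  - eapply is_series_ext; [|apply is_series_scal_C, phi21_term_series].
    intros l; simpl; cring.
  - unfold Cdiv at 5; rewrite Cpow_mult_l, Cpow_inv, Cpow_add_r by exact Hw.
    unfold qpoch2; field; repeat split; auto; apply Cpow_nz, Hw.
Qed.

(** Division by (q)_n (q)_m turns the Gaussian binomials of [q_vandermonde] into the reciprocal
    factorials of [term]. *)
Lemma genpoly_convolution (n m : nat) :
  sum_n (fun i => sum_n (fun j => term i j (n - i)%nat (m - j)%nat) m) n
  = genpoly (n + m) * (t ^ n / qpoch q q n) * (w ^ m / qpoch q q m).
Proof.
  unfold genpoly; rewrite q_vandermonde by exact Hq.
  rewrite <- Cmult_assoc, Cmult_comm, <- csum_mult.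
  apply sum_n_ext_loc; intros i Hi.
  rewrite <- csum_mult; apply sum_n_ext_loc; intros j Hj.
  unfold term, gbin.
  replace (n + m - (i + j))%nat with (n - i + (m - j))%nat by lia.
  replace (t ^ n) with (t ^ i * t ^ (n - i))
    by (rewrite <- Cpow_add_r; f_equal; lia).
  replace (w ^ m) with (w ^ j * w ^ (m - j))
    by (rewrite <- Cpow_add_r; f_equal; lia).
  match goal with |- @eq _ ?a ?b => change (@eq C a b) end.
  field; repeat split; apply qq_neq0.
Qed.

Lemma double_generating_function :
  exists S0 : C,
    is_series (fun k => sum_n (fun j =>
      kap k * w ^ k / qpoch q q (k - j)
      * (qpoch (x * w) q j * (t / w) ^ j / qpoch2 b q q j) * phi j) k) S0
    /\ is_iterated_series (fun n m =>
         genpoly (n + m) * (t ^ n / qpoch q q n) * (w ^ m / qpoch q q m))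
         (cst * S0).
Proof.
  destruct term_bound as [K HK].
  assert (K0 : (0 <= K)%R).
  { assert (H := HK O O O O); simpl in H; pose proof (Cmod_ge_0 (term 0 0 0 0)); lra. }
  assert (Hpow : forall n, (0 <= th ^ n)%R) by (intros n; apply pow_le; lra).
  assert (H1 : (0 < 1 - th)%R) by lra.
  set (Z := fun i j => CSeries (fun l => CSeries (term i j l))).
  set (W := fun i j l => CSeries (term i j l)).
  set (V := fun i l => CSeries (fun j => W i j l)).
  assert (HW : forall i j l,
            (Cmod (W i j l) <= K / (1 - th) * th ^ i * th ^ j * th ^ l)%R).
  { intros i j l; eapply Rle_trans.
    - apply (CSeries_le_geo (K * th ^ i * th ^ j * th ^ l) th); [exact Hth|].
      intros m; apply HK.
    - apply Req_le; field; lra. }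
  assert (HZ : forall i j,
            (Cmod (Z i j) <= K / (1 - th) / (1 - th) * th ^ i * th ^ j)%R).
  { intros i j; eapply Rle_trans.
    - apply (CSeries_le_geo (K / (1 - th) * th ^ i * th ^ j) th); [exact Hth|].
      intros l; apply HW.
    - apply Req_le; field; lra. }
  assert (HV : forall i l,
            (Cmod (V i l) <= K / (1 - th) / (1 - th) * th ^ i * th ^ l)%R).
  { intros i l; eapply Rle_trans.
    - apply (CSeries_le_geo (K / (1 - th) * th ^ i * th ^ l) th); [exact Hth|].
      intros j; eapply Rle_trans; [apply HW | apply Req_le; ring].
    - apply Req_le; field; lra. }
  (* [V] has j already summed and [Z] has l already summed, so this is the exchange of j with l for
     each fixed i. *)
  assert (HVZ : CSeries (fun i => CSeries (V i)) = CSeries (fun i => CSeries (Z i))).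
  { apply CSeries_ext; intros i; unfold V, Z; symmetry.
    apply (CSeries_swap (W i) (K / (1 - th) * th ^ i) th Hth (HW i)). }
  assert (Hbinf : qpoch_inf b q <> 0) by (apply qpoch_inf_neq0; auto).
  assert (Hxwinf : qpoch_inf (x * w) q <> 0) by (apply qpoch_inf_neq0; auto).
  assert (Hcst : cst * / cst = 1) by (unfold cst; field; auto).
  (* The prefactor is contained in every [Z i j]; it can be divided out because neither infinite
     product vanishes. *)
  exists (/ cst * CSeries (fun i => CSeries (Z i))); split.
  - eapply is_series_ext;
      [|apply is_series_scal_C, (is_series_triangle Z _ th Hth HZ)].
    intros k; simpl; rewrite <- csum_mult; apply sum_n_ext_loc; intros j Hj.
    unfold Z; rewrite term_sum_lm.
    replace (j + (k - j))%nat with k by lia.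
    rewrite Cmult_assoc, (Cmult_comm (/ cst)), Hcst, Cmult_1_l; reflexivity.
  - rewrite Cmult_assoc, Hcst, Cmult_1_l, <- HVZ.
    exists (fun n => sum_n (fun i => V i (n - i)%nat) n); split.
    + intros n.
      apply (is_series_ext (fun m => sum_n (fun i => sum_n (fun j =>
               term i j (n - i)%nat (m - j)%nat) m) n)).
      { intros m; apply genpoly_convolution. }
      apply (is_series_sum_n (fun i m => sum_n (fun j =>
               term i j (n - i)%nat (m - j)%nat) m)).
      intros i.
      apply (is_series_triangle (fun j m => term i j (n - i)%nat m)
               (K * th ^ i * th ^ (n - i)) th Hth).
      intros j m; eapply Rle_trans; [apply HK | apply Req_le; ring].
    + apply (is_series_triangle V _ th Hth HV).
Qed.

End Double_sum.

(** * Application to the generalized q-polynomials *)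

Lemma cauchy_poly_qpoch (q x y : C) (n : nat) :
  x <> 0 -> cauchy_poly q x y n = qpoch (y / x) q n * x ^ n.
Proof.
  intros Hx; induction n as [|n IH]; [unfold cauchy_poly, qpoch; simpl; ring|].
  change (cauchy_poly q x y n * (x - q ^ n * y) = qpoch (y / x) q (S n) * x ^ S n).
  rewrite IH, qpoch_S, Cpow_S; field; exact Hx.
Qed.

(** The extra binom(k, 2) in the exponent of [Lpoly] cancels the one inside [qbin_neg], so all
    powers of q merge into [kexp]. *)
Lemma Lpoly_gbin (q lq alpha x y z a : C) (r s : R) (n : nat) :
  (Cmod q < 1)%R -> Cexp lq = q -> x <> 0 ->
  Lpoly q lq r s alpha x y z a n
  = sum_n (fun k => gbin q n k *
      (kfactor q lq alpha a (kexp alpha r s k) z k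
       * (qpoch (y / x) q (n - k) * x ^ (n - k)))) n.
Proof.
  intros Hq Hlq Hx; apply sum_n_ext_loc; intros k Hk.
  rewrite (qbin_INR q lq n k Hq Hlq Hk), (cauchy_poly_qpoch q x y (n - k) Hx).
  unfold qbin_neg, kfactor, qpoch2.
  replace (kexp alpha r s k)
    with (alpha * INR k - binom2 k + (r * binom2 k - s * binom2 (S k) + binom2 k))
    by (unfold kexp; ring).
  rewrite (qpow_plus lq (alpha * INR k - binom2 k)); unfold Cdiv; cring.
Qed.

Lemma kfactor_mult (q lq alpha a e u z : C) (k : nat) :
  kfactor q lq alpha a e (u * z) k = kfactor q lq alpha a e z k * u ^ k.
Proof. unfold kfactor, Cdiv; rewrite Cpow_mult_l; ring. Qed.

(** Common core of both parts. The exponent e is only required to agree with [kexp] pointwise, so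
    that k alpha fits for r = s = 0. The decay at x t is a hypothesis because (i) derives it from
    the 2Phi1 series and (ii) from |x t| < 1. *)
Lemma Lpoly_generating_function (q lq alpha x y z a t w : C) (r s : R)
  (e : nat -> C) :
  (Cmod q < 1)%R -> Cexp lq = q -> x <> 0 -> w <> 0 ->
  (forall i : nat, y * w * q ^ i <> 1) ->
  (forall k, e k = kexp alpha r s k) ->
  (Cmod (w * x) < 1)%R ->
  (exists K th, (0 <= th < 1)%R /\
     geo_le K th (fun i => qpoch (y / x) q i * (x * t) ^ i)) ->
  ex_series_abs (fun k => kfactor q lq alpha a (e k) (w * z) k) ->
  ex_series_abs (fun k => kfactor q lq alpha a (e k) (t * z) k) ->
  exists S0 : C,
    is_series (fun k : nat => sum_n (fun j : nat =>
      kfactor q lq alpha a (e k) (w * z) k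
      / qpoch q q (k - j)
      * (qpoch (x * w) q j * (t / w) ^ j / qpoch2 (y * w) q q j)
      * phi21 (y / x) 0 (y * w * q ^ j) q (x * t)) k) S0
    /\
    is_iterated_series (fun n m : nat =>
      Lpoly q lq r s alpha x y z a (n + m)
      * (t ^ n / qpoch q q n) * (w ^ m / qpoch q q m))
      (qpoch_inf (y * w) q / qpoch_inf (x * w) q * S0).
Proof.
  intros Hq Hlq Hx Hw Hyw He Hwx [K2 [th2 [Hth2 Hpt]]] Hkw Hkt.
  set (kap := fun k => kfactor q lq alpha a (kexp alpha r s k) z k).
  assert (Hgeo : forall u,
    ex_series_abs (fun k => kfactor q lq alpha a (e k) (u * z) k) ->
    exists K th, (0 <= th < 1)%R /\ geo_le K th (fun k => kap k * u ^ k)).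
  { intros u Hu; destruct (kfactor_geo q lq alpha a (u * z) r s Hq) as [K [th [Hth HK]]].
    - eapply ex_series_ext; [|exact Hu]; intros k; simpl; rewrite He; reflexivity.
    - exists K, th; split; [exact Hth|]; intros k.
      unfold kap; rewrite <- kfactor_mult; apply HK. }
  destruct (Hgeo t Hkt) as [K1 [th1 [Hth1 Ht]]].
  destruct (Hgeo w Hkw) as [K3 [th3 [Hth3 Hw3]]].
  rewrite (Cmult_comm w x) in Hwx.
  destruct (qpoch_pow_geo (y / x) q (x * w) Hq Hwx) as [K4 [th4 [Hth4 Hpw]]].
  assert (Hyx : y * w = y / x * (x * w)) by (field; exact Hx).
  rewrite Hyx in *.
  set (th := Rmax (Rmax th1 th3) (Rmax th2 th4)).
  assert (L1 : (th1 <= th)%R).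
  { eapply Rle_trans; [apply Rmax_l | apply Rmax_l]. }
  assert (L3 : (th3 <= th)%R).
  { eapply Rle_trans; [apply Rmax_r | apply Rmax_l]. }
  assert (L2 : (th2 <= th)%R).
  { eapply Rle_trans; [apply Rmax_l | apply Rmax_r]. }
  assert (L4 : (th4 <= th)%R).
  { eapply Rle_trans; [apply Rmax_r | apply Rmax_r]. }
  assert (Lth : (th < 1)%R) by (repeat apply Rmax_lub_lt; lra).
  destruct (double_generating_function q (y / x) x t w kap (Rmax K1 K3)
              (Rmax K2 K4) th) as [S0 [HS HI]]; try assumption; try lra.
  - apply (geo_le_mono K1 _ th1); [lra | apply Rmax_l | exact Ht].
  - apply (geo_le_mono K3 _ th3); [lra | apply Rmax_r | exact Hw3].
  - apply (geo_le_mono K2 _ th2); [lra | apply Rmax_l | exact Hpt].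
  - apply (geo_le_mono K4 _ th4); [lra | apply Rmax_r | exact Hpw].
  - exists S0; split.
    + eapply is_series_ext; [|exact HS]; intros k; apply sum_n_ext; intros j.
      rewrite He, kfactor_mult; reflexivity.
    + destruct HI as [v [Hv HV]]; exists v; split; [|exact HV].
      intros n; eapply is_series_ext; [|exact (Hv n)].
      intros m; simpl; rewrite (Lpoly_gbin q lq) by assumption; reflexivity.
Qed.

Theorem theorem10 (q lq alpha x y z a t w : C)
  (hq0 : q <> 0) (hq1 : (Cmod q < 1)%R) (hlq : Cexp lq = q)
  (hx : x <> 0) (hw : w <> 0)
  (hyw : forall i : nat, y * w * q ^ i <> 1) :
  (forall r s : R,
    (Cmod (w * x) < 1)%R ->
    (forall j : nat,
      ex_series_abs (phi21_term (y / x) 0 (y * w * q ^ j) q (x * t))) ->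
    ex_series_abs (fun k : nat =>
      kfactor q lq alpha a
        (INR k * alpha + r * binom2 k - s * binom2 (S k)) (w * z) k) ->
    ex_series_abs (fun k : nat =>
      kfactor q lq alpha a
        (INR k * alpha + r * binom2 k - s * binom2 (S k)) (t * z) k) ->
    exists S0 : C,
      is_series (fun k : nat => sum_n (fun j : nat =>
        kfactor q lq alpha a
          (INR k * alpha + r * binom2 k - s * binom2 (S k)) (w * z) k
        / qpoch q q (k - j)
        * (qpoch (x * w) q j * (t / w) ^ j / qpoch2 (y * w) q q j)
        * phi21 (y / x) 0 (y * w * q ^ j) q (x * t)) k) S0
      /\
      is_iterated_series (fun n m : nat =>
        Lpoly q lq r s alpha x y z a (n + m)
        * (t ^ n / qpoch q q n) * (w ^ m / qpoch q q m))
        (qpoch_inf (y * w) q / qpoch_inf (x * w) q * S0))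
  /\
  ((Rmax (Cmod (w * x)) (Cmod (x * t)) < 1)%R ->
    ex_series_abs (fun k : nat =>
      kfactor q lq alpha a (INR k * alpha) (w * z) k) ->
    ex_series_abs (fun k : nat =>
      kfactor q lq alpha a (INR k * alpha) (t * z) k) ->
    exists S0 : C,
      is_series (fun k : nat => sum_n (fun j : nat =>
        kfactor q lq alpha a (INR k * alpha) (w * z) k
        / qpoch q q (k - j)
        * (qpoch (x * w) q j * (t / w) ^ j / qpoch2 (y * w) q q j)
        * phi21 (y / x) 0 (y * w * q ^ j) q (x * t)) k) S0
      /\
      is_iterated_series (fun n m : nat =>
        Lpoly q lq 0 0 alpha x y z a (n + m)
        * (t ^ n / qpoch q q n) * (w ^ m / qpoch q q m))
        (qpoch_inf (y * w) q / qpoch_inf (x * w) q * S0)).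
Proof.
  split.
  - intros r s Hwx Hphi Hkw Hkt.
    apply (Lpoly_generating_function q lq alpha x y z a t w r s
             (fun k => INR k * alpha + r * binom2 k - s * binom2 (S k)));
      try assumption; [reflexivity|].
    apply (phi21_abs_geo (y / x) (y * w * q ^ 0)); [exact hq1 | | apply Hphi].
    intros i; rewrite Cmult_1_r; apply hyw.
  - intros Hmax Hkw Hkt.
    apply (Lpoly_generating_function q lq alpha x y z a t w 0 0
             (fun k => INR k * alpha)); try assumption.
    + intros k; unfold kexp; ring.
    + eapply Rle_lt_trans; [apply Rmax_l | exact Hmax].
    + apply qpoch_pow_geo; [exact hq1|].
      eapply Rle_lt_trans; [apply Rmax_r | exact Hmax].
Qed.
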